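(* Let $q\colon\mathbb C\to\mathbb C$ be a polynomial with $\deg q\ge 2$ that has no fixed points on the unit circle $S_0$, and let $f_n(z)=z^n+q(z)$. Then, with convergence taken in the Hausdorff metric: (1) $\lim_{n\to\infty}K(f_n)=\overline{\mathbb D}$ if and only if $q(\overline{\mathbb D})\subset\overline{\mathbb D}$; and (2) $\lim_{n\to\infty}K(f_n)=S_0$ if and only if $q(\overline{\mathbb D})\cap\mathbb D=\emptyset$.
   Context: The filled Julia set $K(f)$ of $f\colon\mathbb C\to\mathbb C$ is the set of points of $\mathbb C$ whose orbit under iteration of $f$ is bounded. $\mathbb D=\{z\in\mathbb C:|z|<1\}$, $\overline{\mathbb D}=\{z\in\mathbb C:|z|\le1\}$, $S_0=\{z\in\mathbb C:|z|=1\}$. For compact sets $A_n,A\subset\mathbb C$, $\lim_{n\to\infty}A_n=A$ in the Hausdorff metric means $d_{\mathcal H}(A_n,A)\to0$, where $d_{\mathcal H}(A,B)=\max\{\sup_{a\in A}\inf_{b\in B}|a-b|,\ \sup_{b\in B}\inf_{a\in A}|a-b|\}$. *)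

(* Defs.v *)
From HB Require Import structures.
From mathcomp Require Import all_boot all_order all_algebra.
From mathcomp Require Import all_classical all_reals all_analysis.
From mathcomp Require Import complex.
Set Implicit Arguments.
Unset Strict Implicit.
Unset Printing Implicit Defensive.
Import Order.TTheory GRing.Theory Num.Theory.
Import numFieldNormedType.Exports.
Import Normc.
Local Open Scope classical_set_scope.
Local Open Scope ring_scope.

(* The norm [`|z|] of [R[i]] takes values in [R[i]]; [normc z : R] is the same
   modulus as a real number ([`|z| = (normc z)%:C]). *)
Definition filled_julia (R : realType) (f : R[i] -> R[i]) : set R[i] :=
  [set z | exists M : R, forall k : nat, normc (iter k f z) <= M].

Definition unit_disk (R : realType) : set R[i] := [set z | normc z < 1].

Definition closed_unit_disk (R : realType) : set R[i] := [set z | normc z <= 1].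

Definition unit_circle (R : realType) : set R[i] := [set z | normc z = 1].

Arguments unit_disk : clear implicits.
Arguments closed_unit_disk : clear implicits.
Arguments unit_circle : clear implicits.

(* Taken in [\bar R], so that it is [+oo], and never a default real value, when
   a supremum is infinite or exactly one of the sets is empty. *)
Definition hausdorff_dist (R : realType) (A B : set R[i]) : \bar R :=
  maxe
    (ereal_sup [set ereal_inf [set (normc (a - b))%:E | b in B] | a in A])
    (ereal_sup [set ereal_inf [set (normc (a - b))%:E | a in A] | b in B]).

Definition hausdorff_cvg (R : realType) (A_ : nat -> set R[i]) (A : set R[i]) :=
  hausdorff_dist (A_ n) A @[n --> \oo] --> (0%E : \bar R).

(* Main.v *)
(** Points outside a neighbourhood of the closed disk escape because [z ^ n]
    dominates there; well inside the disk [z ^ n] is negligible and [f_n] is a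
    perturbation of [q].  On the circle, fixed points of [f_n] are dense in the
    limit, by a second-difference estimate of [log |z ^ n + q z - z|].

    If [q] maps the closed disk into itself, it has a fixed point [a] in the open
    disk and strictly contracts the pseudo-hyperbolic distance to [a] on compact
    sets, so the disks around [a] are trapping regions of [f_n].  If [|q| >= 1] on
    the disk, the strict maximum principle for [1 / q] pushes compact subsets of
    the open disk outside the unit disk in one step.  If [|q|] takes values on
    both sides of [1], it takes the value [1] at some [w] with [|w| < 1]; since
    fixed points of [f_n] accumulate at [q w], their preimages put points of
    [K(f_n)] near [w].

    Complex analysis is replaced by uniform limits of polynomials on the disk and
    averages over roots of unity. *)
Require Import Defs.
From HB Require Import structures.
From mathcomp Require Import all_boot all_order all_algebra.
From mathcomp Require Import all_classical all_reals all_analysis.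
From mathcomp Require Import complex cyclic cyclotomic separable ring lra.
Set Implicit Arguments.
Unset Strict Implicit.
Unset Printing Implicit Defensive.
Import Order.TTheory GRing.Theory Num.Theory.
Import numFieldNormedType.Exports.
Import Normc.
Local Open Scope classical_set_scope.
Local Open Scope ring_scope.

(** * Bernoulli's inequality and the growth and decay of powers *)

Section Powers.
Variable R : realType.
Implicit Types (a e r t M : R) (n : nat).

Lemma bernoulli t n : -1 <= t -> 1 + n%:R * t <= (1 + t) ^+ n.
Proof.
move=> t1; elim: n => [|n IH]; first by rewrite expr0 mul0r addr0.
rewrite exprSr -natr1.
have h : (1 + n%:R * t) * (1 + t) <= (1 + t) ^+ n * (1 + t).
  by apply: ler_wpM2r => //; lra.
have nt : 0 <= n%:R * t ^+ 2 :> R by rewrite mulr_ge0 // sqr_ge0.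
apply: le_trans h; lra.
Qed.

Lemma exists_nat_gt M : exists n, M < n%:R.
Proof.
exists (Num.bound M); case: (leP 0 M) => [/archi_boundP //|M0].
by apply: lt_le_trans M0 _.
Qed.

Lemma expr_unbounded e M : 0 < e ->
  exists N, forall n, (N <= n)%N -> M <= (1 + e) ^+ n.
Proof.
move=> e0; have [N hN] := exists_nat_gt (M / e).
exists N => n Nn; apply: le_trans (bernoulli n _); last by lra.
have : M < N%:R * e by rewrite -ltr_pdivrMr.
have : N%:R * e <= n%:R * e by rewrite ler_pM2r // ler_nat.
lra.
Qed.

Lemma expr_vanishing r e : 0 <= r -> r < 1 -> 0 < e ->
  exists N, forall n, (N <= n)%N -> r ^+ n <= e.
Proof.
move=> r0 r1 e0; have [->|rn0] := eqVneq r 0.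
  by exists 1%N => -[//|n] _; rewrite expr0n /= ltW.
have rp : 0 < r by rewrite lt_def rn0.
have [|N hN] := @expr_unbounded (r^-1 - 1) e^-1.
  by rewrite subr_gt0 invf_gt1.
exists N => n /hN; rewrite addrC subrK exprVn lef_pV2 //.
by rewrite posrE exprn_gt0.
Qed.

(** Stands in for a minimum, which an empty list lacks; it is applied to distances from finite lists
    of roots. *)
Lemma lower_bound_seq (T : eqType) (s : seq T) (f : T -> R) :
  (forall x, x \in s -> 0 < f x) ->
  exists2 t, 0 < t & forall x, x \in s -> t <= f x.
Proof.
elim: s => [|x s IH] h; first by exists 1.
have [y ys|t t0 ht] := IH; first by apply: h; rewrite inE ys orbT.
have fx : 0 < f x by apply: h; rewrite inE eqxx.
exists (Num.min t (f x)); first by rewrite lt_min t0 fx.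
move=> y; rewrite inE => /orP[/eqP->|/ht ty]; rewrite ge_min ?lexx ?orbT //.
by rewrite ty.
Qed.

End Powers.

(** * Modulus estimates for complex numbers and polynomials *)

Section Modulus.
Variable R : realType.
Implicit Types (z w : R[i]) (n : nat) (P : {poly R[i]}).

Lemma normc_norm z : `|z| = (normc z)%:C%C.
Proof. by []. Qed.

Lemma normc_ge0 z : 0 <= normc z.
Proof. by case: z => a b; exact: sqrtr_ge0. Qed.

Lemma normc_eq0 z : (normc z == 0) = (z == 0).
Proof. by apply/eqP/eqP => [/eq0_normc//|->]; rewrite normc0. Qed.

Lemma normc_gt0 z : (0 < normc z) = (z != 0).
Proof. by rewrite lt_def normc_ge0 andbT normc_eq0. Qed.

Lemma normcB z w : normc (z - w) <= normc z + normc w.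
Proof. by rewrite -(normcN w) le_normcD. Qed.

Lemma normc_distC z w : normc (z - w) = normc (w - z).
Proof. by rewrite -normcN opprB. Qed.

Lemma normc_sub_le z w : normc z - normc w <= normc (z - w).
Proof. by have := le_normcD (z - w) w; rewrite subrK; lra. Qed.

Lemma normc_sub_trans z w x : normc (z - x) <= normc (z - w) + normc (w - x).
Proof. by have := le_normcD (z - w) (w - x); rewrite addrA subrK. Qed.

Lemma normcX z n : normc (z ^+ n) = normc z ^+ n.
Proof. by elim: n => [|n IH]; rewrite ?expr0 ?normc1 // !exprS normcM IH. Qed.

Lemma normc_conj z : normc z^*%C = normc z.
Proof. by apply: (@complexI R); rewrite -!normc_norm normcJ. Qed.

Lemma normc_real (x : R) : normc x%:C%C = `|x|.
Proof. by rewrite /normc /= expr0n /= addr0 sqrtr_sqr. Qed.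

Lemma normc_nat n : normc (n%:R : R[i]) = n%:R.
Proof. by rewrite -[n%:R](rmorph_nat (real_complex R)) normc_real normr_nat. Qed.

Lemma normc_sum (I : Type) (s : seq I) (F : I -> R[i]) :
  normc (\sum_(i <- s) F i) <= \sum_(i <- s) normc (F i).
Proof.
elim: s => [|x s IH]; first by rewrite !big_nil normc0.
by rewrite !big_cons; have := le_normcD (F x) (\sum_(i <- s) F i); lra.
Qed.

Lemma normc_prod (I : Type) (s : seq I) (F : I -> R[i]) :
  normc (\prod_(i <- s) F i) = \prod_(i <- s) normc (F i).
Proof. by apply: (big_morph (@normc R)) => [x y|]; rewrite ?normcM ?normc1. Qed.

Lemma sqr_normc_conj z : ((normc z) ^+ 2)%:C%C = z * z^*%C.
Proof. by rewrite -sqr_normc normc_norm rmorphXn. Qed.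

Lemma Re_le_normc z : complex.Re z <= normc z.
Proof.
have := normc_ge_Re z; rewrite normc_norm lecR; apply: le_trans.
exact: ler_norm.
Qed.

Lemma normc_sqrE z : normc z ^+ 2 = complex.Re z ^+ 2 + complex.Im z ^+ 2.
Proof. by case: z => a b /=; rewrite sqr_sqrtr // addr_ge0 // sqr_ge0. Qed.

Lemma normc_unity n z : (0 < n)%N -> z ^+ n = 1 -> normc z = 1.
Proof.
move=> n0 zn; apply/eqP; rewrite -(@pexpr_eq1 _ _ n) ?normc_ge0 //.
by rewrite -normcX zn normc1.
Qed.

Lemma horner_bounded P (r : R) :
  exists2 M, 0 < M & forall z, normc z <= r -> normc P.[z] <= M.
Proof.
elim/poly_ind: P => [|P c [M M0 IH]].
  by exists 1 => // z _; rewrite horner0 normc0.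
exists (M * `|r| + normc c + 1).
  by rewrite ltr_wpDl // addr_ge0 ?normc_ge0 // mulr_ge0 // ltW.
move=> z zr; rewrite hornerMXaddC.
apply: le_trans (le_normcD _ _) _; rewrite normcM.
have : normc P.[z] * normc z <= M * `|r|.
  apply: ler_pM; rewrite ?normc_ge0 ?IH //.
  by apply: le_trans zr (ler_norm _).
lra.
Qed.

(** The exponent overshoots the degree of a nonzero [P] by one; this is harmless, since the bound is
    only set against [z ^ n] with [n] large. *)
Lemma horner_growth P :
  exists2 C, 0 < C & forall z, 1 <= normc z ->
    normc P.[z] <= C * normc z ^+ (size P).
Proof.
elim/poly_ind: P => [|P c [C C0 IH]].
  by exists 1 => // z _; rewrite horner0 normc0 mul1r exprn_ge0 // normc_ge0.
exists (C + normc c + 1); first by rewrite ltr_wpDl // addr_ge0 ?normc_ge0 ?ltW.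
move=> z z1; rewrite hornerMXaddC size_MXaddC.
case: ifP => [/andP[/eqP -> /eqP ->]|_].
  rewrite horner0 mul0r addr0 normc0 expr0 mulr1; lra.
apply: le_trans (le_normcD _ _) _; rewrite normcM.
have h1 : normc P.[z] * normc z <= C * normc z ^+ (size P).+1.
  rewrite exprSr mulrA; apply: ler_wpM2r; rewrite ?normc_ge0 //; exact: IH.
have h2 : 1 <= normc z ^+ (size P).+1 by rewrite exprn_ege1.
have h3 : normc c * 1 <= normc c * normc z ^+ (size P).+1.
  by apply: ler_wpM2l; rewrite ?normc_ge0.
lra.
Qed.

Lemma horner_lipschitz P (r : R) :
  exists2 L, 0 < L & forall z w, normc z <= r -> normc w <= r ->
    normc (P.[z] - P.[w]) <= L * normc (z - w).
Proof.
elim/poly_ind: P => [|P c [L L0 IH]].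
  by exists 1 => // z w _ _; rewrite !horner0 subrr normc0 mul1r normc_ge0.
have [M M0 hM] := horner_bounded P r.
exists (L * `|r| + M); first by rewrite ltr_wpDl // mulr_ge0 // ltW.
move=> z w zr wr; rewrite !hornerMXaddC.
have -> : P.[z] * z + c - (P.[w] * w + c) =
   (P.[z] - P.[w]) * z + P.[w] * (z - w) by ring.
apply: le_trans (le_normcD _ _) _; rewrite !normcM.
have h1 : normc (P.[z] - P.[w]) * normc z <= L * normc (z - w) * `|r|.
  apply: ler_pM; rewrite ?normc_ge0 ?IH //.
  by apply: le_trans zr (ler_norm _).
have h2 : normc P.[w] * normc (z - w) <= M * normc (z - w).
  by apply: ler_wpM2r; rewrite ?normc_ge0 // hM.
lra.
Qed.

Lemma poly_factor P : P != 0 ->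
  exists2 s : seq R[i], P = lead_coef P *: \prod_(r <- s) ('X - r%:P) &
    (size P = (size s).+1)%N /\ (forall r, root P r = (r \in s)).
Proof.
move=> P0; have [s Ps] := closed_field_poly_normal P.
exists s => //; split.
  by rewrite {1}Ps size_scale ?lead_coef_eq0 // size_prod_XsubC.
by move=> r; rewrite {1}Ps rootZ ?lead_coef_eq0 // root_prod_XsubC.
Qed.

Lemma horner_prod_XsubC (s : seq R[i]) z :
  (\prod_(r <- s) ('X - r%:P)).[z] = \prod_(r <- s) (z - r).
Proof. by rewrite horner_prod; apply: eq_bigr => r _; rewrite hornerXsubC. Qed.

Lemma prod_dist_ge (s : seq R[i]) (t : R) z : 0 <= t ->
  (forall r, r \in s -> t <= normc (z - r)) ->
  t ^+ size s <= normc (\prod_(r <- s) (z - r)).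
Proof.
move=> t0; elim: s => [|x s IH] h; first by rewrite big_nil normc1.
rewrite big_cons normcM exprS; apply: ler_pM => //.
- by rewrite exprn_ge0.
- by apply: h; rewrite inE eqxx.
- by apply: IH => r rs; apply: h; rewrite inE rs orbT.
Qed.

(** Over the complex numbers [P] splits, and each linear factor contributes at least [t]. The
    constant depends on [P] and [t] only, so no compactness argument is needed. *)
Lemma horner_lower_bound P (t : R) : P != 0 -> 0 < t ->
  exists2 c, 0 < c & forall z,
    (forall r, root P r -> t <= normc (z - r)) -> c <= normc P.[z].
Proof.
move=> P0 t0; have [s Ps [_ rs]] := poly_factor P0.
exists (normc (lead_coef P) * t ^+ size s).
  by rewrite mulr_gt0 ?exprn_gt0 // normc_gt0 lead_coef_eq0.
move=> z h; rewrite Ps hornerZ horner_prod_XsubC normcM.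
rewrite lead_coefZ (eqP (monic_prod_XsubC _ _ _)) mulr1.
apply: ler_wpM2l; rewrite ?normc_ge0 //; apply: prod_dist_ge; first exact: ltW.
by move=> r; rewrite -rs => /h.
Qed.

End Modulus.

(** * Uniform limits of polynomials on the closed disk *)

Section RootsOfUnity.
Variable R : realType.
Implicit Types (z w : R[i]) (n : nat) (P h : {poly R[i]}).

(** ['X^n - 1] splits and is separable in characteristic zero, so it has [n] distinct roots; a group
    of [n] roots of unity is cyclic. *)
Lemma exists_prim_root n : (0 < n)%N -> exists w : R[i], n.-primitive_root w.
Proof.
move=> n0; pose p : {poly R[i]} := 'X^n - 1.
have [s ps] := closed_field_poly_normal p.
have size_p : size p = n.+1 by rewrite size_XnsubC.
have p_monic : p \is monic by rewrite monicXnsubC.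
rewrite (monicP p_monic) scale1r in ps.
have s_uniq : uniq s.
  by rewrite -separable_prod_XsubC -ps separable_Xn_sub_1 // pnatr_eq0 -lt0n.
have : has n.-primitive_root s.
  have size_s : (n <= size s)%N.
    by have := size_p; rewrite ps size_prod_XsubC => -[->].
  apply: has_prim_root => //.
  apply/allP => r rs; rewrite unity_rootE -subr_eq0.
  have : root p r by rewrite ps root_prod_XsubC.
  by rewrite rootE !hornerE.
by case/hasP => w _ hw; exists w.
Qed.

Lemma sum_expr_prim_root n w m : n.-primitive_root w ->
  \sum_(k < n) (w ^+ k) ^+ m = if (n %| m)%N then n%:R else 0.
Proof.
move=> hw; have xn : (w ^+ m) ^+ n = 1.
  by rewrite -exprM mulnC exprM (prim_expr_order hw) expr1n.
under eq_bigr do rewrite -exprM mulnC exprM.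
case: ifP => hd.
  have /eqP -> : w ^+ m == 1 by rewrite -(prim_order_dvd hw).
  by under eq_bigr do rewrite expr1n; rewrite sumr_const card_ord.
have xne : w ^+ m - 1 != 0 by rewrite subr_eq0 -(prim_order_dvd hw) hd.
by apply: (mulfI xne); rewrite -subrX1 xn subrr mulr0.
Qed.

(** Discrete form of Cauchy's coefficient formula, exact because [n] exceeds the degree of [h]. The
    exponent [n - j] plays the role of [- j]. *)
Lemma coef_prim_root n w h j : n.-primitive_root w -> (size h <= n)%N ->
  (j < n)%N -> \sum_(k < n) h.[w ^+ k] * (w ^+ k) ^+ (n - j) = n%:R * h`_j.
Proof.
move=> hw hn jn.
transitivity (\sum_(i < n) h`_i * \sum_(k < n) (w ^+ k) ^+ (i + (n - j))).
  under eq_bigr => k _ do rewrite (horner_coef_wide _ hn) mulr_suml.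
  rewrite exchange_big; apply: eq_bigr => i _; rewrite mulr_sumr.
  by apply: eq_bigr => k _; rewrite -mulrA -exprD.
rewrite (bigD1 (Ordinal jn)) //= sum_expr_prim_root // subnKC ?(ltnW jn) //.
rewrite dvdnn big1 ?addr0 1?mulrC // => i ij; rewrite sum_expr_prim_root //.
case: ifP; last by rewrite mulr0.
(* A nonzero contribution would need [i] congruent to [j] modulo [n], and both are below [n]. *)
rewrite addnBA ?(ltnW jn) // => hd; case/eqP: ij; apply: val_inj => /=.
have : (i + n - j == 0 %[mod n])%N by rewrite -/(dvdn n _) mod0n.
have ji : (j <= i + n)%N by rewrite (leq_trans (ltnW jn)) // leq_addl.
rewrite -(eqn_modDr j) subnK // add0n modnDr !modn_small //.
by move/eqP.
Qed.

Lemma normc_prim_root n w k : n.-primitive_root w -> normc (w ^+ k) = 1.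
Proof.
move=> hw; rewrite normcX (@normc_unity _ n) ?expr1n //.
- exact: prim_order_gt0 hw.
- exact: prim_expr_order hw.
Qed.

Lemma cauchy_coef h (M : R) j :
  (forall z, normc z = 1 -> normc h.[z] <= M) -> normc h`_j <= M.
Proof.
move=> hM; pose n := (maxn (size h) j.+1).
have n0 : (0 < n)%N by rewrite (leq_trans _ (leq_maxr _ _)).
have [w hw] := exists_prim_root n0.
have hc := coef_prim_root hw (leq_maxl _ _) (leq_maxr _ _).
have n0' : 0 < n%:R :> R by rewrite ltr0n.
rewrite -(ler_pM2l n0') -[X in X * normc _](@normc_nat R) -normcM -hc.
apply: le_trans (normc_sum _ _) _.
have -> : n%:R * M = \sum_(k < n) M by rewrite sumr_const card_ord mulr_natl.
apply: ler_sum => k _; rewrite normcM (normcX (w ^+ k)).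
by rewrite (normc_prim_root k hw) expr1n mulr1 hM // (normc_prim_root k hw).
Qed.

Lemma sum_geom_le (x : R) n : 0 <= x -> x < 1 ->
  \sum_(i < n) x ^+ i <= (1 - x)^-1.
Proof.
move=> x0 x1; have x1' : 0 < 1 - x by rewrite subr_gt0.
rewrite -(ler_pM2l x1') mulfV ?gt_eqF // -opprB mulNr -subrX1 opprB.
by rewrite lerBlDr lerDl exprn_ge0.
Qed.

(** Cauchy's estimate bounds every coefficient by [M], and the geometric series sums the terms. The
    loss [1 / (1 - |z|)] is harmless: it is absorbed by taking high powers, and it equals 1 at the
    centre. *)
Lemma cauchy_bound_poly h (M : R) z :
  (forall z, normc z = 1 -> normc h.[z] <= M) -> normc z < 1 ->
  normc h.[z] <= M / (1 - normc z).
Proof.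
move=> hM z1; have M0 : 0 <= M.
  by apply: le_trans (hM 1 (normc1 _)); exact: normc_ge0.
rewrite horner_coef; apply: le_trans (normc_sum _ _) _.
apply: (@le_trans _ _ (\sum_(i < size h) M * normc z ^+ i)).
  apply: ler_sum => i _; rewrite normcM normcX.
  by apply: ler_wpM2r; rewrite ?exprn_ge0 ?normc_ge0 // cauchy_coef.
by rewrite -mulr_sumr ler_wpM2l // sum_geom_le // normc_ge0.
Qed.

End RootsOfUnity.

(** * The disk algebra and its Cauchy bound *)

Section DiskAlgebra.
Variable R : realType.
Implicit Types (F G : R[i] -> R[i]) (z w : R[i]) (P h : {poly R[i]}).

(** This approximation property stands in for being continuous on the closed disk and holomorphic
    inside; Cauchy estimates pass from polynomials to the limit. *)
Definition disk_algebra F := forall e : R, 0 < e ->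
  exists h : {poly R[i]}, forall z, normc z <= 1 -> normc (F z - h.[z]) <= e.

Lemma disk_algebra_poly P : disk_algebra (horner P).
Proof. by move=> e e0; exists P => z _; rewrite subrr normc0 ltW. Qed.

Lemma disk_algebra_ext F G : (forall z, normc z <= 1 -> F z = G z) ->
  disk_algebra F -> disk_algebra G.
Proof.
move=> FG hF e /hF[h hh]; exists h => z z1.
by rewrite -FG // hh.
Qed.

Lemma disk_algebra_bounded F : disk_algebra F ->
  exists2 M, 0 < M & forall z, normc z <= 1 -> normc (F z) <= M.
Proof.
move=> hF; have [h hh] := hF 1 ltr01; have [M M0 hM] := horner_bounded h 1.
exists (1 + M); first by rewrite addr_gt0.
move=> z z1; have := le_normcD (F z - h.[z]) h.[z]; rewrite subrK.
by have := hh _ z1; have := hM _ z1; lra.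
Qed.

Lemma disk_algebraM F G : disk_algebra F -> disk_algebra G ->
  disk_algebra (fun z => F z * G z).
Proof.
move=> hF hG e e0.
have [A A0 hA] := disk_algebra_bounded hF.
have [B B0 hB] := disk_algebra_bounded hG.
(* The cap at 1 makes the product of the two errors at most [e1], so the total error is at most
   [e1 * (A + B + 1)]. *)
pose e1 := Num.min 1 (e / (A + B + 1)).
have s0 : 0 < A + B + 1 by lra.
have e10 : 0 < e1 by rewrite lt_min ltr01 divr_gt0.
have e11 : e1 <= 1 by rewrite ge_min lexx.
have e1e : e1 * (A + B + 1) <= e by rewrite -ler_pdivlMr // ge_min lexx orbT.
have [f hf] := hF _ e10; have [g hg] := hG _ e10.
exists (f * g) => z z1; rewrite hornerM.
have -> : F z * G z - f.[z] * g.[z] =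
   F z * (G z - g.[z]) + (F z - f.[z]) * G z
   - (F z - f.[z]) * (G z - g.[z]) by ring.
apply: le_trans (normcB _ _) _.
have h1 := le_normcD (F z * (G z - g.[z])) ((F z - f.[z]) * G z).
rewrite !normcM in h1 *.
have h2 : normc (F z) * normc (G z - g.[z]) <= A * e1.
  by apply: ler_pM; rewrite ?normc_ge0 ?hA ?hg.
have h3 : normc (F z - f.[z]) * normc (G z) <= e1 * B.
  by apply: ler_pM; rewrite ?normc_ge0 ?hB ?hf.
have h4 : normc (F z - f.[z]) * normc (G z - g.[z]) <= e1 * 1.
  by apply: ler_pM; rewrite ?normc_ge0 ?hf //; apply: le_trans (hg _ z1) _.
lra.
Qed.

Lemma disk_algebraX F m : disk_algebra F -> disk_algebra (fun z => F z ^+ m).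
Proof.
move=> hF; elim: m => [|m IH].
  apply: (@disk_algebra_ext (horner 1)); last exact: disk_algebra_poly.
  by move=> z _; rewrite hornerC expr0.
apply: (@disk_algebra_ext (fun z => F z * F z ^+ m)); last exact: disk_algebraM.
by move=> z _; rewrite exprS.
Qed.

(** The approximants are the partial sums of the geometric series in [P]; the remainder
    [P ^ N / (1 - P)] is at most [r ^ N / (1 - r)]. *)
Lemma disk_algebra_geom P (r : R) : r < 1 ->
  (forall z, normc z <= 1 -> normc P.[z] <= r) ->
  disk_algebra (fun z => (1 - P.[z])^-1).
Proof.
move=> r1 hP e e0; have r0 : 0 <= r.
  by apply: le_trans (hP 0 _); rewrite ?normc_ge0 // normc0.
have r1' : 0 < 1 - r by rewrite subr_gt0.
have [N hN] := expr_vanishing r0 r1 (mulr_gt0 e0 r1').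
exists (\sum_(i < N) P ^+ i) => z z1.
have d1 : 1 - r <= normc (1 - P.[z]).
  by have := normc_sub_le 1 P.[z]; rewrite normc1; have := hP _ z1; lra.
have dn : 1 - P.[z] != 0 by rewrite -normc_gt0; lra.
have -> : (1 - P.[z])^-1 - (\sum_(i < N) P ^+ i).[z] =
    P.[z] ^+ N / (1 - P.[z]).
  apply: (mulIf dn); rewrite mulrBl mulVf // mulfVK // horner_sum.
  under eq_bigr do rewrite horner_exp.
  have := subrX1 P.[z] N; rewrite -[P.[z] - 1]opprB mulNr => hgeom.
  by rewrite mulrC -hgeom addrC subrK.
rewrite normcM normcV normcX ler_pdivrMr; last by lra.
apply: (@le_trans _ _ (r ^+ N)).
  by rewrite lerXn2r ?nnegrE ?normc_ge0 // hP.
apply: le_trans (hN _ (leqnn _)) _.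
by rewrite ler_pM2l.
Qed.

(** All roots [r] of [P] have modulus above 1, so each [1 / (z - r) = - r^-1 / (1 - z / r)] is a
    geometric series; products stay in the algebra. *)
Lemma disk_algebra_inv P : (forall z, normc z <= 1 -> P.[z] != 0) ->
  disk_algebra (fun z => P.[z]^-1).
Proof.
move=> hP; have P0 : P != 0.
  by apply/eqP => P0; have := hP 0; rewrite P0 horner0 eqxx normc0 ler01 => /(_ isT).
have [s Ps [_ rs]] := poly_factor P0.
have hs r : r \in s -> 1 < normc r.
  by rewrite -rs rootE ltNge => /eqP Pr; apply/negP => /hP; rewrite Pr eqxx.
have hprod : disk_algebra (fun z => (\prod_(r <- s) (z - r))^-1).
  elim: s hs {Ps rs} => [|r s IH] hs.
    apply: (@disk_algebra_ext (horner 1)); last exact: disk_algebra_poly.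
    by move=> z _; rewrite big_nil hornerC invr1.
  have r1 : 1 < normc r by apply: hs; rewrite inE eqxx.
  have rn0 : r != 0 by rewrite -normc_gt0; lra.
  have h1 : disk_algebra (fun z => (1 - (r^-1 *: 'X).[z])^-1).
    apply: (@disk_algebra_geom _ (normc r)^-1); first by rewrite invf_lt1 //; lra.
    move=> z z1; rewrite hornerZ hornerX normcM normcV.
    by rewrite ler_piMr // invr_ge0 normc_ge0.
  have h2 := disk_algebraM (disk_algebra_poly (- r^-1)%:P) h1.
  have h3 : disk_algebra (fun z => (\prod_(r <- s) (z - r))^-1).
    by apply: IH => x xs; apply: hs; rewrite inE xs orbT.
  apply: disk_algebra_ext (disk_algebraM h2 h3) => z z1.
  rewrite big_cons invfM hornerC hornerZ hornerX; congr (_ * _).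
  have zr : z - r != 0.
    by rewrite subr_eq0; apply/eqP => zr; move: r1; rewrite -zr; lra.
  have zr' : r - z != 0 by rewrite -oppr_eq0 opprB.
  by field; rewrite rn0 zr zr' ?(eqP rn0).
apply: disk_algebra_ext (disk_algebraM
  (disk_algebra_poly (lead_coef P)^-1%:P) hprod) => z z1.
rewrite [in RHS]Ps hornerZ hornerC horner_prod_XsubC invfM.
by rewrite Ps lead_coefZ (eqP (monic_prod_XsubC _ _ _)) mulr1.
Qed.

Lemma cauchy_bound F (M : R) z : disk_algebra F ->
  (forall z, normc z = 1 -> normc (F z) <= M) -> normc z < 1 ->
  normc (F z) <= M / (1 - normc z).
Proof.
move=> hF hM z1; have z1' : 0 < 1 - normc z by rewrite subr_gt0.
(* An approximation error [e / c] is paid twice: once at [z], and once on the circle, where the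
   Cauchy bound multiplies it by [(1 - normc z)^-1]. *)
apply/ler_addgt0Pr => e e0; pose c := (1 - normc z)^-1 + 1.
have c0 : 0 < c by rewrite addr_gt0 // invr_gt0.
have [h hh] := hF (e / c) (divr_gt0 e0 c0).
have hb : normc h.[z] <= (M + e / c) / (1 - normc z).
  apply: cauchy_bound_poly => // x x1.
  have := hh x; rewrite x1 lexx normc_distC => /(_ isT).
  by have := le_normcD (h.[x] - F x) (F x); rewrite subrK; have := hM _ x1; lra.
have := le_normcD (F z - h.[z]) h.[z]; rewrite subrK.
have := hh _ (ltW z1).
have ec : e / c * c = e by rewrite mulfVK // gt_eqF.
have : e / c * (1 - normc z)^-1 + e / c = e by rewrite -[RHS]ec /c mulrDr mulr1.
lra.
Qed.

End DiskAlgebra.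

(** * A strict maximum principle *)

Section StrictMaximum.
Variable R : realType.
Implicit Types (F : R[i] -> R[i]) (z w : R[i]) (P W : {poly R[i]}).

(* Only the zeros of [W] in the open disk are factored out: they stay away from
   the circle, while the other ones stay away from smaller disks. *)
Lemma split_roots_disk W : W != 0 ->
  exists (W1 W2 : {poly R[i]}) (c : R), [/\ 0 < c, W = W1 * W2,
    (forall z, normc z = 1 -> c <= normc W1.[z]) &
    (forall z, normc z < 1 -> W2.[z] != 0)].
Proof.
move=> W0; have [s Ws [_ rs]] := poly_factor W0.
pose inD (r : R[i]) := normc r < 1.
exists (lead_coef W *: \prod_(r <- s | inD r) ('X - r%:P)),
       (\prod_(r <- s | ~~ inD r) ('X - r%:P)).
have [t t0 ht] : exists2 t : R, 0 < t &
    forall r, r \in [seq x <- s | inD x] -> t <= 1 - normc r.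
  by apply: lower_bound_seq => r; rewrite mem_filter subr_gt0 => /andP[].
exists (normc (lead_coef W) * t ^+ size [seq x <- s | inD x]); split.
- by rewrite mulr_gt0 ?exprn_gt0 // normc_gt0 lead_coef_eq0.
- by rewrite [LHS]Ws -scalerAl [in LHS](bigID inD).
- move=> z z1; rewrite hornerZ normcM -big_filter horner_prod_XsubC.
  apply: ler_wpM2l; rewrite ?normc_ge0 //.
  apply: prod_dist_ge; first exact: ltW.
  move=> r /ht; have := normc_sub_le z r; rewrite z1; lra.
- move=> z z1; rewrite -big_filter horner_prod_XsubC -normc_gt0 normc_prod.
  rewrite big_seq prodr_gt0 // => r.
  rewrite mem_filter /inD -leNgt => /andP[r1 _].
  by rewrite normc_distC; have := normc_sub_le r z; lra.
Qed.

(** Since [(1 - t) ^ m * (1 + t) ^ m <= 1], replacing the second factor by its Bernoulli lower bound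
    [1 + m t] gives the estimate. *)
Lemma expr_defect_le (t : R) m : 0 <= t -> t <= 1 -> (0 < m)%N ->
  (1 - t) ^+ m * t <= m%:R^-1.
Proof.
move=> t0 t1 m0; have m0' : 0 < m%:R :> R by rewrite ltr0n.
have h1 : (1 - t) ^+ m * (1 + m%:R * t) <= 1.
  have h : (1 - t) ^+ m * (1 + m%:R * t) <= (1 - t) ^+ m * (1 + t) ^+ m.
    by rewrite ler_wpM2l ?exprn_ge0 ?subr_ge0 // bernoulli //; lra.
  apply: le_trans h _; rewrite -exprMn; apply: exprn_ile1; nra.
have h2 : 0 <= (1 - t) ^+ m by rewrite exprn_ge0 ?subr_ge0.
rewrite -(ler_pM2l m0') mulfV ?gt_eqF //.
move: h1; rewrite mulrDr mulr1; lra.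
Qed.

(* The Cauchy bound applied to [F ^ 2m * W2] gains a factor [1 / m], because
   [|F| ^ 2m * |W|] is at most [max t (1 - t)^m / c] on the circle. *)
Lemma strict_maximum F W (c r : R) : disk_algebra F -> W != 0 -> 0 < c ->
  (forall z, normc z = 1 -> normc (F z) ^+ 2 <= 1 - c * normc W.[z]) ->
  0 <= r -> r < 1 ->
  exists2 d, 0 < d /\ d < 1 & forall z, normc z <= r -> normc (F z) <= 1 - d.
Proof.
move=> hF W0 c0 hFW r0 r1.
have [W1 [W2 [c1 [c10 W12 hW1 hW2]]]] := split_roots_disk W0.
have W20 : W2 != 0 by apply: contra_neq W0 => W20; rewrite W12 W20 mulr0.
have r1' : 0 < 1 - r by rewrite subr_gt0.
(* The roots of [W2] have modulus at least 1, hence lie at distance at least [1 - r] from the disk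
   of radius [r]. *)
have [b b0 hb] := horner_lower_bound W20 r1'.
have hb' z : normc z <= r -> b <= normc W2.[z].
  move=> zr; apply: hb => x; rewrite rootE => /eqP Wx.
  have : 1 <= normc x by rewrite leNgt; apply/negP => /hW2; rewrite Wx eqxx.
  by rewrite normc_distC; have := normc_sub_le x z; lra.
pose K := c * c1 * b * (1 - r).
have K0 : 0 < K by rewrite !mulr_gt0.
(* The Cauchy bound, divided by [b], will read [|F z| ^ 2m <= 1 / (m K)]; this [m] makes it at most
   one half. *)
have [m hm] := exists_nat_gt (2 / K).
have m0 : (0 < m)%N.
  by rewrite -(ltr0n R); apply: lt_trans hm; rewrite divr_gt0.
have m0' : 0 < m%:R :> R by rewrite ltr0n.
have hcirc z : normc z = 1 ->
    normc (F z ^+ (2 * m) * W2.[z]) <= (m%:R * c * c1)^-1.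
  move=> z1; rewrite normcM normcX exprM.
  have hW := hFW _ z1; have h1 := hW1 _ z1.
  have Wz : normc W.[z] = normc W1.[z] * normc W2.[z].
    by rewrite W12 hornerM normcM.
  have t0 : 0 <= c * normc W.[z] by rewrite mulr_ge0 ?normc_ge0 // ltW.
  have t1 : c * normc W.[z] <= 1.
    by have := sqr_ge0 (normc (F z)); lra.
  have hd := expr_defect_le t0 t1 m0.
  have h2 : (normc (F z) ^+ 2) ^+ m <= (1 - c * normc W.[z]) ^+ m.
    by rewrite lerXn2r ?nnegrE ?exprn_ge0 ?normc_ge0 // subr_ge0.
  have h3 : (normc (F z) ^+ 2) ^+ m * (c * normc W.[z]) <= m%:R^-1.
    by apply: le_trans hd; apply: ler_wpM2r.
  have h4 : (normc (F z) ^+ 2) ^+ m * normc W2.[z] * (c * c1)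
      <= (normc (F z) ^+ 2) ^+ m * (c * normc W.[z]).
    have -> : (normc (F z) ^+ 2) ^+ m * (c * normc W.[z]) =
       (normc (F z) ^+ 2) ^+ m * normc W2.[z] * (c * normc W1.[z]).
      by rewrite Wz; ring.
    apply: ler_wpM2l; first by rewrite mulr_ge0 ?exprn_ge0 ?normc_ge0.
    by rewrite ler_wpM2l // ltW.
  rewrite -mulrA invfM ler_pdivlMr ?mulr_gt0 //.
  by apply: le_trans h4 h3.
(* By Bernoulli, [(1 - d) ^ 2m >= 1 - 2 m d = 1 / 2], so comparing [2m]-th powers yields
   [|F z| <= 1 - d]. *)
pose d : R := (4 * m)%:R^-1.
have m40 : (0 < 4 * m)%N by rewrite muln_gt0.
have d0 : 0 < d by rewrite invr_gt0 ltr0n.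
have d1 : d < 1.
  by rewrite invf_lt1 ?ltr0n // ltr1n; case: (m) m0 => // k _; rewrite mulnS.
exists d => // z zr; have z1 : normc z < 1 by lra.
have := cauchy_bound (disk_algebraM (disk_algebraX (2 * m) hF)
  (disk_algebra_poly W2)) hcirc z1.
rewrite normcM normcX => hz.
have hE : normc (F z) ^+ (2 * m) <= 2^-1.
  have e1 : normc (F z) ^+ (2 * m) * b <= (m%:R * c * c1)^-1 / (1 - r).
    apply: (@le_trans _ _ (normc (F z) ^+ (2 * m) * normc W2.[z])).
      by rewrite ler_wpM2l ?exprn_ge0 ?normc_ge0 // hb'.
    apply: le_trans hz _.
    apply: ler_wpM2l; first by rewrite invr_ge0 !mulr_ge0 // ltW.
    by rewrite lef_pV2 ?posrE; lra.
  have e2 : (m%:R * c * c1)^-1 / (1 - r) = b * (m%:R * K)^-1.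
    by rewrite /K; field; rewrite ?gt_eqF.
  have e3 : (m%:R * K)^-1 <= 2^-1.
    rewrite lef_pV2 ?posrE ?mulr_gt0 // ltW // -ltr_pdivrMr //.
  rewrite -(ler_pM2r b0); apply: le_trans e1 _; rewrite e2 mulrC.
  by rewrite ler_wpM2r // ltW.
have hB : 2^-1 <= (1 - d) ^+ (2 * m).
  apply: le_trans (bernoulli _ _); last by lra.
  rewrite mulrN /d !natrM invfM.
  have : m%:R * m%:R^-1 = 1 :> R by rewrite mulfV // gt_eqF.
  lra.
rewrite -(@ler_pXn2r _ (2 * m)) ?nnegrE ?normc_ge0 ?subr_ge0 ?(ltW d1) //.
  exact: le_trans hE hB.
by rewrite muln_gt0.
Qed.

End StrictMaximum.

(** * Polynomials preserving the unit circle *)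

Section CircleDefect.
Variable R : realType.
Implicit Types (z : R[i]) (q : {poly R[i]}).

(* On the unit circle [z^-1] is the conjugate of [z], so that
   [circle_defect q] evaluates to [z ^ deg q * (1 - |q z| ^ 2)]. *)
Definition circle_defect q : {poly R[i]} :=
  'X^((size q).-1) - q * \poly_(i < size q) (q`_((size q).-1 - i))^*%C.

Lemma normc_circle_defect q z : normc z = 1 ->
  normc (circle_defect q).[z] = `|1 - normc q.[z] ^+ 2|.
Proof.
move=> z1; have zz : z * z^*%C = 1 by rewrite -sqr_normc_conj z1 expr1n.
have z0 : z != 0 by rewrite -normc_gt0 z1.
have -> : (circle_defect q).[z] =
   z ^+ (size q).-1 * (1 - normc q.[z] ^+ 2)%:C%C; last first.
  by rewrite normcM normcX z1 expr1n mul1r normc_real.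
have -> : (1 - normc q.[z] ^+ 2)%:C%C = 1 - q.[z] * q.[z]^*%C.
  by rewrite -sqr_normc_conj rmorphB rmorph1.
rewrite /circle_defect hornerD hornerN hornerXn hornerM horner_poly.
rewrite mulrBr mulr1; congr (_ - _); rewrite mulrCA; congr (_ * _).
have [->|q0] := eqVneq q 0.
  by rewrite size_poly0 big_ord0 horner0 conjc0 mulr0.
have sq : (0 < size q)%N by rewrite size_poly_gt0.
rewrite horner_coef rmorph_sum mulr_sumr.
(* Multiplying the conjugate of [q z] by [z ^ deg q] reverses the order of the coefficients. *)
rewrite [RHS](reindex_inj rev_ord_inj) /=; apply: eq_bigr => i _.
have ei : (size q - i.+1 = (size q).-1 - i)%N by rewrite -subn1 -subnDA add1n.
rewrite ei rmorphM rmorphXn mulrCA; congr (_ * _).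
have il : (i <= (size q).-1)%N by rewrite -ltnS prednK.
rewrite -{1}(subnK il) exprD [_ * z ^+ i]mulrC -mulrA -exprMn.
by rewrite [z * _]zz expr1n mulr1.
Qed.

(** Vanishing makes [q] a divisor of a power of ['X], so [q z = a z ^ k], and [|a| = 1] because [q]
    preserves the circle. Any solution of [z ^ (k - 1) = a^-1] is then a fixed point of modulus 1.
    Without fixed points on the circle, the defect is thus nonzero, as the strict maximum principle
    requires. *)
Lemma circle_defect_eq0 q : (1 < (size q).-1)%N -> circle_defect q = 0 ->
  exists2 z, normc z = 1 & q.[z] = z.
Proof.
move=> sq h0; have q1 z : normc z = 1 -> normc q.[z] = 1.
  move=> z1; have := normc_circle_defect q z1; rewrite h0 horner0 normc0.
  move/esym/eqP; rewrite normr_eq0 subr_eq0 eq_sym.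
  by rewrite pexpr_eq1 ?normc_ge0 // => /eqP.
have : (q %| ('X - 0%:P) ^+ (size q).-1)%R.
  rewrite subr0; move/eqP: h0; rewrite subr_eq0 => /eqP ->; exact: dvdp_mulr.
move=> /dvdp_exp_XsubCP[k _]; rewrite subr0 => qk.
have /eqpP[[c d] /andP[/= c0 d0] cd] := qk.
have k2 : k = (size q).-1 by have := eqp_size qk; rewrite size_polyXn => ->.
have qz z : q.[z] = (d / c) * z ^+ k.
  have := congr1 (fun p => p.[z]) cd; rewrite !hornerE => h.
  by rewrite mulrAC -h mulrAC mulfV // mul1r.
have a1 : normc (d / c) = 1.
  by rewrite -(q1 1) ?normc1 // qz expr1n mulr1.
set a := d / c in qz a1.
have a0 : a != 0 by rewrite -normc_gt0 a1.
have k1 : (0 < k.-1)%N by rewrite k2 -ltnS prednK // (ltn_trans _ sq).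
have [z hz] := solve_monicpoly (fun i => if i == 0%N then a^-1 else 0) k1.
have {}hz : z ^+ k.-1 = a^-1.
  rewrite hz (bigD1 (Ordinal k1)) //= expr0 mulr1 big1 ?addr0 // => i.
  by rewrite -val_eqE /= => /negPf ->; rewrite mul0r.
exists z.
  apply/eqP; rewrite -(@pexpr_eq1 _ _ k.-1) ?normc_ge0 //.
  by rewrite -normcX hz normcV a1 invr1.
rewrite qz -(@prednK k) ?(ltn_trans _ k1) //; last by case: (k) k1.
by rewrite exprSr hz mulrA mulfV // mul1r.
Qed.

End CircleDefect.

(** * Self-maps of the disk *)

Section InteriorFixedPoint.
Variable R : realType.
Implicit Types (z w a : R[i]) (q : {poly R[i]}).

Lemma Re_inv_ge0 z : 0 <= complex.Re z -> 0 <= complex.Re z^-1.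
Proof.
by case: z => a b /= a0; rewrite divr_ge0 // addr_ge0 // sqr_ge0.
Qed.

Lemma normc_addJ z : normc (z + z^*%C) = `|2 * complex.Re z|.
Proof.
by rewrite addcJ normcM normc_nat normc_real normrM normr_nat.
Qed.

(* Otherwise [G z = z / (z - q z)] is a limit of polynomials [z H(z)] whose real
   part is nonnegative on the circle and has mean [G 0 = 0]; this forces
   [H 0 = 0], whereas [H 0] approximates [- 1 / q 0]. *)
Lemma interior_fixed_point q :
  (forall z, normc z <= 1 -> normc q.[z] <= 1) ->
  (forall z, normc z = 1 -> q.[z] <> z) ->
  exists2 a, normc a < 1 & q.[a] = a.
Proof.
move=> hq hf; apply: contrapT => nofix.
pose P := 'X - q.
have PE z : P.[z] = z - q.[z] by rewrite hornerD hornerN hornerX.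
have Pn z : normc z <= 1 -> P.[z] != 0.
  rewrite PE subr_eq0 le_eqVlt => /orP[/eqP z1|z1]; apply/eqP => zq.
    exact: (hf z).
  by apply: nofix; exists z.
have P00 : normc 0 <= 1 :> R by rewrite normc0.
pose x := normc (P.[0]^-1).
have x0 : 0 < x by rewrite normc_gt0 invr_eq0 Pn.
(* With error [e = x / 8] the averages below give [|H 0| <= 4 e = x / 2], too small to approximate a
   number of modulus [x] within [x / 8]. *)
have [|H hH] := disk_algebra_inv Pn (e := x / 8); first by rewrite divr_gt0.
set e := x / 8 in hH.
(* Large enough that averaging [H], [H * 'X] and [H * 'X^2] over the [n]-th roots of unity returns
   exactly their constant coefficients. *)
pose n := (size H).+3.
have [w hw] := @exists_prim_root R n isT.
have nn0 : 0 < n%:R :> R by rewrite ltr0n.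
have mean0 (h : {poly R[i]}) : (size h <= n)%N ->
    \sum_(k < n) h.[w ^+ k] = n%:R * h`_0.
  move=> hn; rewrite -(coef_prim_root hw hn (j := 0)) //.
  apply: eq_bigr => k _; rewrite subn0 -exprM mulnC exprM.
  by rewrite (prim_expr_order hw) expr1n mulr1.
have s0 : (size H <= n)%N by rewrite /n -addn3 leq_addr.
have s1 : (size (H * 'X)%R <= n)%N.
  apply: leq_trans (size_polyMleq _ _) _; rewrite size_polyX addn2 /n.
  exact: leq_trans (leqnSn _) (leqnSn _).
have s2 : (size (H * 'X^2)%R <= n)%N.
  by apply: leq_trans (size_polyMleq _ _) _; rewrite size_polyXn addn3 /n.
have m0 := mean0 _ s0; have m1 := mean0 _ s1; have m2 := mean0 _ s2.
rewrite coefMX /= mulr0 in m1; rewrite coefMXn /= mulr0 in m2.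
(* On the circle the left side is [|2 Re (z H z)|], and [Re (z H z) >= - e], whence the bound
   without absolute value. On averaging, the sum inside the left modulus has mean [H 0], and the
   real part on the right has mean 0. *)
have bd k : normc (H.[w ^+ k] + ((H * 'X^2).[w ^+ k])^*%C) <=
    2 * complex.Re (H * 'X).[w ^+ k] + 4 * e.
  set z := w ^+ k; have z1 : normc z = 1 by apply: normc_prim_root hw.
  have zz : z * z^*%C = 1 by rewrite -sqr_normc_conj z1 expr1n.
  have zn0 : z != 0 by rewrite -normc_gt0 z1.
  rewrite !hornerM !hornerX.
  have -> : H.[z] + (H.[z] * (z * z))^*%C = z^*%C * (H.[z] * z + (H.[z] * z)^*%C).
    have e2 : (H.[z] * (z * z))^*%C = H.[z]^*%C * (z^*%C * z^*%C).
      by rewrite !rmorphM.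
    have e3 : (H.[z] * z)^*%C = H.[z]^*%C * z^*%C by rewrite rmorphM.
    by rewrite e2 e3 -[X in X + _ = _]mulr1 -zz; ring.
  rewrite normcM normc_conj z1 mul1r normc_addJ.
  have hz : normc (P.[z]^-1 - H.[z]) <= e by apply: hH; rewrite z1.
  have h1 : 0 <= complex.Re (P.[z]^-1 * z).
    have -> : P.[z]^-1 * z = (1 - q.[z] * z^*%C)^-1.
      have -> : 1 - q.[z] * z^*%C = P.[z] / z.
        rewrite PE mulrBl mulfV //; congr (_ - _ * _).
        by apply: (mulfI zn0); rewrite zz mulfV.
      by rewrite invfM invrK.
    apply: Re_inv_ge0.
    have := Re_le_normc (q.[z] * z^*%C); rewrite normcM normc_conj z1 mulr1.
    have hqz : normc q.[z] <= 1 by apply: hq; rewrite z1.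
    move: (q.[z] * z^*%C) => u; case: u => u v /= ?; lra.
  have h2 : complex.Re (P.[z]^-1 * z) - complex.Re (H.[z] * z) <= e.
    have := Re_le_normc ((P.[z]^-1 - H.[z]) * z).
    rewrite normcM z1 mulr1 mulrBl.
    by move: (P.[z]^-1 * z) (H.[z] * z) => [? ?] [? ?] /= ?; lra.
  have e0 : 0 <= e := le_trans (normc_ge0 _) hz.
  by rewrite ler_norml; apply/andP; split; lra.
have hs : normc (n%:R * H`_0) <= n%:R * (4 * e).
  have -> : n%:R * H`_0 =
      \sum_(k < n) (H.[w ^+ k] + ((H * 'X^2).[w ^+ k])^*%C).
    by rewrite big_split /= m0 -rmorph_sum m2 rmorph0 addr0.
  apply: le_trans (normc_sum _ _) _.
  apply: (@le_trans _ _ (\sum_(k < n)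
      (2 * complex.Re (H * 'X).[w ^+ k] + 4 * e))).
    by apply: ler_sum => k _; exact: bd.
  rewrite big_split /= sumr_const card_ord -mulr_sumr.
  have -> : \sum_(k < n) complex.Re (H * 'X).[w ^+ k] =
      complex.Re (\sum_(k < n) (H * 'X).[w ^+ k]).
    by rewrite (big_morph (@complex.Re R) (id1 := 0) (op1 := +%R)) // => -[? ?] [? ?].
  by rewrite m1 /= mulr0 add0r -[_ *+ n]mulr_natl.
rewrite normcM normc_nat ler_pM2l // -horner_coef0 in hs.
have hH0 : normc (P.[0]^-1 - H.[0]) <= e by apply: hH.
have := le_normcD (P.[0]^-1 - H.[0]) H.[0]; rewrite subrK -/x.
rewrite /e in hs hH0; lra.
Qed.

End InteriorFixedPoint.

(** * A strict Schwarz-Pick inequality at an interior fixed point *)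

Section SchwarzPick.
Variable R : realType.
Implicit Types (z w a : R[i]) (q : {poly R[i]}).

(** The two moduli are the denominator and numerator of the pseudo-hyperbolic distance from [z] to
    [a]; the identity is kept free of division. *)
Lemma moebius_identity a z : normc (1 - a^*%C * z) ^+ 2 - normc (z - a) ^+ 2 =
  (1 - normc a ^+ 2) * (1 - normc z ^+ 2).
Proof.
by rewrite !normc_sqrE; case: a z => [a b] [c d] /=; ring.
Qed.

Lemma moebius_denom_gt0 a z : normc a < 1 -> normc z <= 1 ->
  1 - normc a <= normc (1 - a^*%C * z).
Proof.
move=> a1 z1; have := normc_sub_le 1 (a^*%C * z).
rewrite normc1 normcM normc_conj.
have : normc a * normc z <= normc a * 1 by rewrite ler_wpM2l ?normc_ge0.
lra.
Qed.

(** The strict maximum principle is applied to the ratio [g] of the Moebius images of [q z] and [z].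
    Its singularity at [a] is removed by dividing [q - a] by ['X - a]; on the circle the Moebius
    image of [z] has modulus 1. *)
Lemma schwarz_pick_strict q a (r : R) :
  (forall z, normc z <= 1 -> normc q.[z] <= 1) ->
  circle_defect q != 0 -> normc a < 1 -> q.[a] = a -> 0 <= r -> r < 1 ->
  exists2 d, 0 < d /\ d < 1 & forall z, normc z <= r ->
    normc (q.[z] - a) * normc (1 - a^*%C * z) <=
    (1 - d) * normc (z - a) * normc (1 - a^*%C * q.[z]).
Proof.
move=> hq W0 a1 qa r0 r1.
have [s hs] : exists s, q - a%:P = s * ('X - a%:P).
  by apply/factor_theorem; rewrite rootE !hornerE qa subrr.
have sE z : s.[z] * (z - a) = q.[z] - a.
  have := congr1 (fun p => p.[z]) hs.
  by rewrite hornerM hornerXsubC hornerD hornerN hornerC => <-.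
pose g z := (s * (1 - a^*%C *: 'X)).[z] * (1 - (a^*%C *: q).[z])^-1.
have gE z : g z = s.[z] * (1 - a^*%C * z) / (1 - a^*%C * q.[z]).
  by rewrite /g hornerM hornerD hornerN !hornerZ hornerX hornerC.
have hg : disk_algebra g.
  apply: disk_algebraM (disk_algebra_poly _) _.
  apply: (@disk_algebra_geom _ _ (normc a)) => // z /hq qz.
  by rewrite hornerZ normcM normc_conj ler_piMr ?normc_ge0.
have a2 : normc a ^+ 2 < 1 by rewrite expr_lt1 ?normc_ge0.
(* On the circle [1 - |g z| ^ 2] equals [(1 - |a| ^ 2) (1 - |q z| ^ 2)] over a squared denominator
   that is at most 4. *)
pose c := (1 - normc a ^+ 2) / 4.
have c0 : 0 < c by rewrite divr_gt0 // subr_gt0.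
have hgW z : normc z = 1 ->
    normc (g z) ^+ 2 <= 1 - c * normc (circle_defect q).[z].
  move=> z1; have qz : normc q.[z] <= 1 by apply: hq; rewrite z1.
  have qz2 : normc q.[z] ^+ 2 <= 1 by rewrite expr_le1 ?normc_ge0.
  rewrite normc_circle_defect // ger0_norm ?subr_ge0 //.
  have D0 := moebius_denom_gt0 a1 qz.
  have D2 : normc (1 - a^*%C * q.[z]) <= 2.
    have := normcB 1 (a^*%C * q.[z]); rewrite normc1 normcM normc_conj.
    have : normc a * normc q.[z] <= 1 * 1.
      by apply: ler_pM; rewrite ?normc_ge0 // ltW.
    lra.
  rewrite gE normcM normcV normcM.
  have /eqP := moebius_identity a z.
  rewrite z1 expr1n subrr mulr0 subr_eq0 eqrXn2 ?normc_ge0 // => /eqP ->.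
  rewrite -normcM sE.
  have := moebius_identity a q.[z].
  set D := normc (1 - _) in D0 D2 *; set u := normc (q.[z] - a).
  move: (normc q.[z] ^+ 2) qz2 => y y1 hid.
  have DD : 0 < D by lra.
  rewrite exprMn exprVn ler_pdivrMr ?exprn_gt0 //.
  have -> : u ^+ 2 = D ^+ 2 - 4 * c * (1 - y).
    have -> : 4 * c = 1 - normc a ^+ 2 by rewrite /c mulrC mulfVK ?pnatr_eq0.
    by rewrite -hid; ring.
  have D4 : D ^+ 2 <= 2 ^+ 2 by rewrite lerXn2r ?nnegrE // ltW.
  have : c * (1 - y) * D ^+ 2 <= c * (1 - y) * 2 ^+ 2.
    by rewrite ler_wpM2l // mulr_ge0 ?subr_ge0 // ltW.
  lra.
have [d hd hmax] := strict_maximum hg W0 c0 hgW r0 r1.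
exists d => // z zr; have z1 : normc z <= 1 by lra.
have D0 : 0 < normc (1 - a^*%C * q.[z]).
  by have := moebius_denom_gt0 a1 (hq _ z1); lra.
have := hmax _ zr; rewrite gE normcM normcV ler_pdivrMr // normcM => h.
rewrite -sE normcM mulrAC -[X in _ <= X]mulrAC.
by rewrite ler_wpM2r ?normc_ge0.
Qed.

End SchwarzPick.

(** * Escape and fixed points of z^n + q(z) *)

Section FilledJulia.
Variable R : realType.
Implicit Types (f : R[i] -> R[i]) (z w : R[i]) (q : {poly R[i]}).

Lemma filled_julia_image f z : filled_julia f z -> filled_julia f (f z).
Proof. by case=> M hM; exists M => k; rewrite -iterSr. Qed.

Lemma filled_julia_preimage f z : filled_julia f (f z) -> filled_julia f z.
Proof.
case=> M hM; exists (Num.max (normc z) M) => -[|k].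
  by rewrite /= le_max lexx.
by rewrite iterSr le_max hM orbT.
Qed.

Lemma filled_julia_fixed f z : f z = z -> filled_julia f z.
Proof. by move=> fz; exists (normc z) => k; rewrite iter_fix. Qed.

(** For large [n] one step at least doubles the modulus of any such point, so its orbit is
    unbounded. *)
Lemma escape_outside_disk q (e : R) : 0 < e ->
  exists N, forall n, (N <= n)%N -> forall z, 1 + e <= normc z ->
    ~ filled_julia (fun z => z ^+ n + q.[z]) z.
Proof.
move=> e0; have [C C0 hC] := horner_growth q.
have [N hN] := expr_unbounded (C + 2) e0.
exists (N + (size q).+1)%N => n Nn z hz [M hM].
pose f := fun z => z ^+ n + q.[z].
have double x : 1 + e <= normc x -> 2 * normc x <= normc (f x).
  move=> hx; have x1 : 1 <= normc x by lra.
  pose k := (n - (size q).+1)%N.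
  have nk : n = (k.+1 + size q)%N.
    by rewrite addSnnS /k subnK // (leq_trans (leq_addl _ _) Nn).
  have Nk : (N <= k)%N by rewrite leq_subRL ?(leq_trans (leq_addl _ _) Nn) // addnC.
  have h1 : C + 2 <= normc x ^+ k.
    apply: le_trans (hN _ Nk) _.
    by rewrite lerXn2r ?nnegrE ?normc_ge0 //; lra.
  have h2 := normc_sub_le (x ^+ n) (- q.[x]).
  rewrite normcN opprK normcX in h2.
  have h3 := hC _ x1.
  have h4 : 1 <= normc x ^+ size q by rewrite exprn_ege1.
  have h5 : (C + 2) * normc x <= normc x ^+ k.+1.
    by rewrite exprSr ler_wpM2r ?normc_ge0.
  have h6 : C * 1 <= C * normc x by rewrite ler_pM2l.
  have h7 : 1 * (normc x ^+ k.+1 - C) <=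
      normc x ^+ size q * (normc x ^+ k.+1 - C).
    by apply: ler_wpM2r => //; lra.
  apply: le_trans h2; rewrite nk exprD; lra.
have grow k : normc z * (1 + 1) ^+ k <= normc (iter k f z).
  elim: k => [|k IH]; first by rewrite expr0 mulr1.
  rewrite iterS; apply: le_trans (double _ _).
    by rewrite exprSr; lra.
  have : 1 <= (1 + 1 : R) ^+ k by rewrite exprn_ege1 //; lra.
  move=> h; apply: le_trans IH; apply: le_trans hz _.
  by rewrite ler_peMr ?normc_ge0.
have [k hk] := exists_nat_gt M.
have := hM k; have := grow k; have := @bernoulli R 1 k.
have z1 : 1 <= normc z by lra.
have : 1 * (1 + 1) ^+ k <= normc z * (1 + 1) ^+ k.
  by apply: ler_wpM2r => //; rewrite exprn_ge0 //; lra.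
rewrite -/f; lra.
Qed.

(* The second difference of [log |z - r|] at step [d] is [O(d ^ 2)]. *)
Lemma three_point_prod (s : seq R[i]) w (d e : R) : 0 <= d -> 0 < e ->
  d <= e ^+ 2 / 2 -> normc w = 1 -> (forall r, r \in s -> e <= normc (w - r)) ->
  normc (\prod_(r <- s) ((1 + d)%:C%C * w - r)) *
  normc (\prod_(r <- s) ((1 - d)%:C%C * w - r)) <=
  (1 + d / 2) ^+ size s * normc (\prod_(r <- s) (w - r)) ^+ 2.
Proof.
move=> d0 e0 de w1; elim: s => [|r s IH] hs.
  by rewrite !big_nil normc1 expr0 expr1n !mulr1.
have {}IH : _ := IH (fun x xs => hs x (@mem_behead _ (r :: s) _ xs)).
rewrite !big_cons !normcM exprMn [size _]/= exprS.
rewrite [X in X <= _]mulrACA [X in _ <= X]mulrACA.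
apply: ler_pM IH; rewrite ?mulr_ge0 ?normc_ge0 //.
rewrite -normcM.
(* The first-order terms in [d] cancel. Since [d <= |w - r| ^ 2 / 2], the remaining [d ^ 2] costs
   only a factor [1 + d / 2] per root. *)
have -> : ((1 + d)%:C%C * w - r) * ((1 - d)%:C%C * w - r) =
   (w - r) ^+ 2 - (d ^+ 2)%:C%C * w ^+ 2.
  by rewrite rmorphD rmorphB rmorphXn rmorph1; ring.
apply: le_trans (normcB _ _) _.
rewrite normcX [X in _ + X]normcM normcX w1 expr1n mulr1 normc_real.
rewrite ger0_norm ?sqr_ge0 //.
have h1 : e ^+ 2 <= normc (w - r) ^+ 2.
  rewrite lerXn2r ?nnegrE ?normc_ge0 ?(ltW e0) //.
  by apply: hs; rewrite inE eqxx.
have h2 : d * d <= d * (normc (w - r) ^+ 2 / 2) by rewrite ler_wpM2l //; lra.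
by rewrite [d ^+ 2]expr2; lra.
Qed.

(** If all roots of [z ^ n + q z - z] stay at distance [e] from [w], the three-point inequality
    applies. Its left side grows like [(1 + d) ^ n], its right side is at most a constant times
    [(1 + d / 2) ^ n]: absurd for large [n], uniformly in [w]. *)
Lemma fixed_points_near_circle q (e : R) : 0 < e ->
  (forall z, normc z = 1 -> q.[z] <> z) ->
  exists N, forall n, (N <= n)%N -> forall w, normc w = 1 ->
    exists2 z, normc (z - w) < e & z ^+ n + q.[z] = z.
Proof.
move=> e0 hf; pose p := q - 'X.
have pE z : p.[z] = q.[z] - z by rewrite hornerD hornerN hornerX.
have p0 : p != 0.
  apply/eqP => p0; apply: (hf 1); first exact: normc1.
  by apply/eqP; rewrite -subr_eq0 -pE p0 horner0.
have [t t0 ht] : exists2 t : R, 0 < t &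
    forall r, root p r -> t <= `|normc r - 1|.
  have [s _ [_ rs]] := poly_factor p0.
  have [r rs'|t t0 ht] := @lower_bound_seq R _ s (fun r => `|normc r - 1|).
    rewrite normr_gt0 subr_eq0; apply/eqP => r1.
    by move: rs'; rewrite -rs rootE pE subr_eq0 => /eqP; exact: hf.
  by exists t => // r; rewrite rs => /ht.
have t20 : 0 < t / 2 by rewrite divr_gt0.
have [c c0 hc] := horner_lower_bound p0 t20.
have [P0 P00 hP0] := horner_bounded p 2.
(* The first bound serves the three-point inequality, the second keeps [(1 - d) w] at distance
   [t / 2] from the roots of [p], and the third gives [(1 + d / 2) (1 + d / 4) <= 1 + d]. *)
pose d := Num.min (e ^+ 2 / 2) (Num.min (t / 2) (1 / 2)).
have d0 : 0 < d by rewrite !lt_min !divr_gt0 ?exprn_gt0.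
have [de dt d12] : [/\ d <= e ^+ 2 / 2, d <= t / 2 & d <= 1 / 2].
  by split; rewrite !ge_min lexx ?orbT.
(* Solves [(M - P0) * (c / 2) = (1 + P0) ^ 2 + 1], which exceeds the bound [(1 + P0) ^ 2] available
   at [w]. *)
pose M := 2 * ((1 + P0) ^+ 2 + 1) / c + P0.
have d40 : 0 < d / 4 by rewrite divr_gt0.
have [N1 hN1] := expr_unbounded M d40.
have c20 : 0 < c / 2 by rewrite divr_gt0.
have dm0 : 0 <= 1 - d by lra.
have dm1 : 1 - d < 1 by lra.
have [N2 hN2] := expr_vanishing dm0 dm1 c20.
exists (maxn (size p) (maxn N1 N2)) => n; rewrite !geq_max => /and3P[np n1 n2].
move=> w w1; apply: contrapT => nofix.
pose F := 'X^n + p.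
have FE z : F.[z] = z ^+ n + p.[z] by rewrite hornerD hornerXn.
have size_F : size F = n.+1 by rewrite size_polyDl size_polyXn.
have F0 : F != 0 by rewrite -size_poly_eq0 size_F.
have F_monic : F \is monic.
  by rewrite monicE lead_coefDl ?size_polyXn // lead_coefXn.
have [s Fs [size_s rs]] := poly_factor F0.
rewrite (monicP F_monic) scale1r in Fs.
have {}size_s : size s = n by move: size_s; rewrite size_F => -[].
have hs r : r \in s -> e <= normc (w - r).
  rewrite -rs rootE FE pE => /eqP Fr; rewrite leNgt; apply/negP => rw.
  apply: nofix; exists r; first by rewrite normc_distC.
  by apply/eqP; rewrite -subr_eq0 -addrA Fr.
have Fprod z : F.[z] = \prod_(r <- s) (z - r).
  by rewrite Fs horner_prod_XsubC.
have := three_point_prod (ltW d0) e0 de w1 hs.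
rewrite -!Fprod size_s !FE.
set zp := (1 + d)%:C%C * w; set zm := (1 - d)%:C%C * w.
have nzp : normc zp = 1 + d.
  by rewrite normcM w1 mulr1 normc_real ger0_norm //; lra.
have nzm : normc zm = 1 - d.
  by rewrite normcM w1 mulr1 normc_real ger0_norm //; lra.
have hp : (1 + d) ^+ n - P0 <= normc (zp ^+ n + p.[zp]).
  have := normc_sub_le (zp ^+ n) (- p.[zp]).
  rewrite normcN opprK normcX nzp.
  have : normc p.[zp] <= P0 by apply: hP0; rewrite nzp; lra.
  lra.
have hm : c / 2 <= normc (zm ^+ n + p.[zm]).
  have := normc_sub_le p.[zm] (- zm ^+ n).
  rewrite normcN opprK [p.[zm] + _]addrC normcX nzm.
  have : c <= normc p.[zm].
    apply: hc => r /ht; have := normc_sub_le zm r; have := normc_sub_le r zm.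
    rewrite [normc (r - zm)]normc_distC nzm => a b.
    by case: (ger0P (normc r - 1)) => *; lra.
  have := hN2 _ n2; lra.
have hw : normc (w ^+ n + p.[w]) <= 1 + P0.
  apply: le_trans (le_normcD _ _) _; rewrite normcX w1 expr1n lerD2l.
  by apply: hP0; rewrite w1; lra.
have hw2 : normc (w ^+ n + p.[w]) ^+ 2 <= (1 + P0) ^+ 2.
  by rewrite lerXn2r ?nnegrE ?normc_ge0 //; lra.
set X := (1 + d / 2) ^+ n.
have X1 : 1 <= X by rewrite exprn_ege1 //; lra.
have hX : X * M <= (1 + d) ^+ n.
  apply: (@le_trans _ _ (X * (1 + d / 4) ^+ n)).
    by rewrite ler_wpM2l ?hN1 //; lra.
  rewrite -exprMn lerXn2r ?nnegrE ?mulr_ge0; try lra.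
  have : d * d <= d * (1 / 2) by rewrite ler_wpM2l // ltW.
  lra.
have hMP : (M - P0) * (c / 2) = (1 + P0) ^+ 2 + 1.
  by rewrite /M; field; rewrite gt_eqF.
have M0 : 0 <= M - P0.
  by rewrite /M addrK divr_ge0 ?mulr_ge0 ?addr_ge0 ?sqr_ge0 // ltW.
have hXP : X * (M - P0) <= (1 + d) ^+ n - P0.
  have : 1 * P0 <= X * P0 by rewrite ler_wpM2r // ltW.
  lra.
have h1 : X * (M - P0) * (c / 2) <=
    normc (zp ^+ n + p.[zp]) * normc (zm ^+ n + p.[zm]).
  apply: ler_pM => //; first by rewrite mulr_ge0 //; lra.
    exact: ltW.
  exact: le_trans hp.
have h2 : X * normc (w ^+ n + p.[w]) ^+ 2 <= X * (1 + P0) ^+ 2.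
  by rewrite ler_wpM2l //; lra.
rewrite -mulrA hMP mulrDr mulr1 in h1; lra.
Qed.

End FilledJulia.

(** * The families z^n + q(z) inside the disk *)

Section LimitSets.
Variable R : realType.
Implicit Types (z w : R[i]) (q : {poly R[i]}).
Local Notation fam q n := (fun z : R[i] => z ^+ n + q.[z]).

Lemma disk_in_filled_julia q (r : R) : (2 <= (size q).-1)%N ->
  (forall z, normc z = 1 -> q.[z] <> z) ->
  (forall z, normc z <= 1 -> normc q.[z] <= 1) -> 0 <= r -> r < 1 ->
  exists N, forall n, (N <= n)%N -> forall z, normc z <= r ->
    filled_julia (fam q n) z.
Proof.
move=> dq hf hq r0 r1.
have W0 : circle_defect q != 0.
  by apply/eqP => /(circle_defect_eq0 dq)[z /hf].
have [a a1 qa] := interior_fixed_point hq hf.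
have a2 : normc a ^+ 2 < 1 by rewrite expr_lt1 ?normc_ge0.
have a20 : 0 <= normc a ^+ 2 by rewrite exprn_ge0 ?normc_ge0.
have r2 : r ^+ 2 < 1 by rewrite expr_lt1.
have r20 : 0 <= r ^+ 2 by rewrite exprn_ge0.
(* By the Moebius identity, points of modulus at most [r] have squared pseudo-hyperbolic distance at
   most [1 - k] from [a], and [rho ^ 2 >= 1 - k]. The trapping region [V] of radius [rho] thus
   contains them. *)
pose k := (1 - normc a ^+ 2) * (1 - r ^+ 2) / 4.
have k0 : 0 < k by rewrite divr_gt0 // mulr_gt0 // subr_gt0.
have k1 : k < 1.
  have : (1 - normc a ^+ 2) * (1 - r ^+ 2) <= 1 * 1 by apply: ler_pM; lra.
  by rewrite /k; lra.
pose rho := 1 - k / 2.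
have rho0 : 0 < rho by rewrite /rho; lra.
have rho1 : rho < 1 by rewrite /rho; lra.
have rho2 : 1 - k <= rho ^+ 2.
  by have := sqr_ge0 (k / 2); rewrite /rho !expr2; lra.
have rho21 : rho ^+ 2 < 1 by rewrite expr_lt1 // ltW.
pose V z := normc (z - a) <= rho * normc (1 - a^*%C * z).
have DV z : V z -> normc z <= 1.
  move=> Vz; have h := moebius_identity a z.
  have h1 : normc (z - a) ^+ 2 <= (rho * normc (1 - a^*%C * z)) ^+ 2.
    by rewrite lerXn2r ?nnegrE ?mulr_ge0 ?normc_ge0 // ltW.
  rewrite exprMn in h1.
  have h2 : rho ^+ 2 * normc (1 - a^*%C * z) ^+ 2 <=
      1 * normc (1 - a^*%C * z) ^+ 2.
    by rewrite ler_wpM2r ?sqr_ge0 // ltW.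
  have h3 : 0 <= (1 - normc a ^+ 2) * (1 - normc z ^+ 2) by lra.
  rewrite pmulr_rge0 ?subr_gt0 // subr_ge0 in h3.
  by rewrite expr_le1 ?normc_ge0 in h3.
have am : 0 < (1 - normc a) ^+ 2 by rewrite exprn_gt0 // subr_gt0.
(* The same identity gives [1 - |z| ^ 2 >= k'] on [V], so [V] lies in the disk of radius [r' < 1],
   where [z ^ n] is uniformly small. *)
pose k' := (1 - normc a) ^+ 2 * (1 - rho ^+ 2).
have k'0 : 0 < k' by rewrite mulr_gt0 // subr_gt0.
have k'1 : k' <= 1.
  have : (1 - normc a) ^+ 2 <= 1.
    by rewrite expr_le1 ?subr_ge0 ?(ltW a1) //; have := normc_ge0 a; lra.
  move=> h; have : k' <= 1 * 1.
    by apply: ler_pM => //; try lra; have := sqr_ge0 rho; lra.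
  by rewrite mulr1.
pose r' := 1 - k' / 2.
have r'0 : 0 <= r' by rewrite /r'; lra.
have r'1 : r' < 1 by rewrite /r'; lra.
have Vr' z : V z -> normc z <= r'.
  move=> Vz; have z1 := DV _ Vz; have h := moebius_identity a z.
  have h1 : normc (z - a) ^+ 2 <= (rho * normc (1 - a^*%C * z)) ^+ 2.
    by rewrite lerXn2r ?nnegrE ?mulr_ge0 ?normc_ge0 // ltW.
  rewrite exprMn in h1.
  have D := moebius_denom_gt0 a1 z1.
  have h2 : (1 - normc a) ^+ 2 <= normc (1 - a^*%C * z) ^+ 2.
    by rewrite lerXn2r ?nnegrE ?normc_ge0 ?subr_ge0 // ltW.
  have h3 : k' <= normc (1 - a^*%C * z) ^+ 2 * (1 - rho ^+ 2).
    by rewrite ler_wpM2r // subr_ge0 ltW.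
  have z2 : normc z ^+ 2 <= 1 by rewrite expr_le1 ?normc_ge0.
  have h4 : (1 - normc a ^+ 2) * (1 - normc z ^+ 2) <= 1 * (1 - normc z ^+ 2).
    by rewrite ler_wpM2r ?subr_ge0 //; lra.
  have h5 : normc z ^+ 2 <= r' ^+ 2.
    by have := sqr_ge0 (k' / 2); rewrite /r' !expr2 in h4 *; lra.
  by rewrite ler_pXn2r ?nnegrE ?normc_ge0 in h5.
have rV z : normc z <= r -> V z.
  move=> zr; have z1 : normc z <= 1 by lra.
  have h := moebius_identity a z.
  have D2 : normc (1 - a^*%C * z) ^+ 2 <= 2 ^+ 2.
    rewrite lerXn2r ?nnegrE ?normc_ge0 //.
    have := normcB 1 (a^*%C * z); rewrite normc1 normcM normc_conj.
    have : normc a * normc z <= 1 * 1.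
      by apply: ler_pM; rewrite ?normc_ge0 // ltW.
    lra.
  have z2 : normc z ^+ 2 <= r ^+ 2 by rewrite lerXn2r ?nnegrE ?normc_ge0.
  have h1 : (1 - normc a ^+ 2) * (1 - r ^+ 2) <=
      (1 - normc a ^+ 2) * (1 - normc z ^+ 2).
    by rewrite ler_wpM2l ?subr_ge0 ?(ltW a2) //; lra.
  have h2 : k * normc (1 - a^*%C * z) ^+ 2 <= k * 2 ^+ 2.
    by rewrite ler_wpM2l // ltW.
  have h3 : (1 - k) * normc (1 - a^*%C * z) ^+ 2 <=
      rho ^+ 2 * normc (1 - a^*%C * z) ^+ 2.
    by rewrite ler_wpM2r ?sqr_ge0.
  have k4 : k * 2 ^+ 2 = (1 - normc a ^+ 2) * (1 - r ^+ 2).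
    by rewrite /k; field.
  have : normc (z - a) ^+ 2 <= (rho * normc (1 - a^*%C * z)) ^+ 2.
    by rewrite exprMn; lra.
  by rewrite ler_pXn2r // nnegrE ?mulr_ge0 ?normc_ge0 // ltW.
have [d [d0 d1] hd] := schwarz_pick_strict hq W0 a1 qa r'0 r'1.
(* Adding [x ^ n] costs at most [eta] in the numerator and [rho * eta] in the denominator term; the
   contraction leaves a margin of at least [2 * eta]. *)
pose eta := d * rho * (1 - normc a) / 2.
have eta0 : 0 < eta by rewrite divr_gt0 // !mulr_gt0 // subr_gt0.
have [N hN] := expr_vanishing r'0 r'1 eta0.
exists N => n Nn z /rV Vz.
have step x : V x -> V (fam q n x).
  move=> Vx; have x1 := DV _ Vx; have xr := Vr' _ Vx.
  have qx1 := hq _ x1.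
  have D0 := moebius_denom_gt0 a1 x1.
  have Dq := moebius_denom_gt0 a1 qx1.
  have xn : normc (x ^+ n) <= eta.
    rewrite normcX; apply: le_trans (hN _ Nn).
    by rewrite lerXn2r ?nnegrE ?normc_ge0.
  have h1 := hd _ xr.
  have h2 : (1 - d) * normc (x - a) * normc (1 - a^*%C * q.[x]) <=
    (1 - d) * rho * normc (1 - a^*%C * q.[x]) * normc (1 - a^*%C * x).
    have -> : (1 - d) * rho * normc (1 - a^*%C * q.[x]) * normc (1 - a^*%C * x) =
      (1 - d) * (rho * normc (1 - a^*%C * x)) * normc (1 - a^*%C * q.[x]) by ring.
    by rewrite ler_wpM2r ?normc_ge0 // ler_wpM2l ?subr_ge0 ?(ltW d1).
  have Dx0 : 0 < normc (1 - a^*%C * x) by lra.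
  have h3 : normc (q.[x] - a) <= (1 - d) * rho * normc (1 - a^*%C * q.[x]).
    by rewrite -(ler_pM2r Dx0); apply: le_trans h1 h2.
  have h4 : normc (x ^+ n + q.[x] - a) <= normc (x ^+ n) + normc (q.[x] - a).
    by rewrite -addrA le_normcD.
  have h5 : normc (1 - a^*%C * q.[x]) - eta <=
      normc (1 - a^*%C * (x ^+ n + q.[x])).
    have := normc_sub_le (1 - a^*%C * q.[x]) (a^*%C * x ^+ n).
    rewrite normcM normc_conj -addrA -opprD [_ * q.[x] + _]addrC -mulrDr.
    have : normc a * normc (x ^+ n) <= 1 * normc (x ^+ n).
      by rewrite ler_wpM2r ?normc_ge0 // ltW.
    lra.
  have h6 : rho * (normc (1 - a^*%C * q.[x]) - eta) <=
      rho * normc (1 - a^*%C * (x ^+ n + q.[x])).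
    by rewrite ler_wpM2l // ltW.
  have h7 : d * rho * (1 - normc a) <= d * rho * normc (1 - a^*%C * q.[x]).
    by rewrite ler_wpM2l // mulr_ge0 // ltW.
  have h8 : rho * eta <= 1 * eta by rewrite ler_wpM2r // ltW.
  have h9 : eta * 2 = d * rho * (1 - normc a) by rewrite /eta mulfVK ?pnatr_eq0.
  rewrite /V; lra.
exists 1 => m; apply: DV.
by elim: m => [//|m IH]; rewrite iterS; apply: step.
Qed.

(** The strict maximum principle for [1 / q] yields [|q z| >= 1 + d] for [|z| <= r]. Once
    [|z ^ n| <= d / 2], the first image has modulus at least [1 + d / 2] and escapes. *)
Lemma disk_escapes q (r : R) : (2 <= (size q).-1)%N ->
  (forall z, normc z = 1 -> q.[z] <> z) ->
  (forall z, normc z <= 1 -> 1 <= normc q.[z]) -> 0 <= r -> r < 1 ->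
  exists N, forall n, (N <= n)%N -> forall z, normc z <= r ->
    ~ filled_julia (fam q n) z.
Proof.
move=> dq hf hq r0 r1.
have W0 : circle_defect q != 0.
  by apply/eqP => /(circle_defect_eq0 dq)[z /hf].
have qn0 z : normc z <= 1 -> q.[z] != 0.
  by move=> /hq; rewrite -normc_gt0; lra.
have [M M0 hM] := horner_bounded q 1.
have M20 : 0 < M ^+ 2 by rewrite exprn_gt0.
have c0 : 0 < (M ^+ 2)^-1 by rewrite invr_gt0.
have hcirc z : normc z = 1 ->
    normc (q.[z]^-1) ^+ 2 <= 1 - (M ^+ 2)^-1 * normc (circle_defect q).[z].
  move=> z1; rewrite normc_circle_defect // distrC normcV exprVn.
  have z1' : normc z <= 1 by rewrite z1.
  have y1 : 1 <= normc q.[z] ^+ 2 by rewrite exprn_ege1 // hq.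
  have yM : normc q.[z] ^+ 2 <= M ^+ 2.
    by rewrite lerXn2r ?nnegrE ?normc_ge0 ?hM // ltW.
  rewrite ger0_norm ?subr_ge0 //; move: (normc q.[z] ^+ 2) y1 yM => y y1 yM.
  have y0 : 0 < y by lra.
  have : (M ^+ 2)^-1 * (y - 1) <= y^-1 * (y - 1).
    by rewrite ler_wpM2r ?subr_ge0 // lef_pV2.
  by rewrite [y^-1 * _]mulrBr mulVf ?gt_eqF // mulr1; lra.
have [d [d0 d1] hd] := strict_maximum (disk_algebra_inv qn0) W0 c0 hcirc r0 r1.
have d20 : 0 < d / 2 by rewrite divr_gt0.
have [N1 hN1] := @escape_outside_disk R q _ d20.
have [N2 hN2] := expr_vanishing r0 r1 d20.
exists (maxn N1 N2) => n; rewrite geq_max => /andP[n1 n2] z zr.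
move=> /filled_julia_image; apply: hN1 => //.
have z1 : normc z <= 1 by lra.
have qz : 1 + d <= normc q.[z].
  have qz0 : 0 < normc q.[z] by rewrite normc_gt0 qn0.
  have := hd _ zr; rewrite normcV -[X in X <= _]mul1r ler_pdivrMr // => h.
  have : d * 1 <= d * normc q.[z] by rewrite ler_wpM2l ?hq // ltW.
  lra.
have zn : normc (z ^+ n) <= d / 2.
  rewrite normcX; apply: le_trans (hN2 _ n2).
  by rewrite lerXn2r ?nnegrE ?normc_ge0.
have := normc_sub_le q.[z] (- z ^+ n).
rewrite normcN opprK addrC; rewrite [q.[z] + _]addrC; lra.
Qed.

Lemma ball_escapes q z0 : normc z0 < 1 -> 1 < normc q.[z0] ->
  exists2 e : R, 0 < e & exists N, forall n, (N <= n)%N ->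
    forall z, normc (z - z0) < e -> ~ filled_julia (fam q n) z.
Proof.
(* Moving from [z0] to [z] and adding [z ^ n] each lose at most [m], leaving modulus at least
   [1 + 2 m]. *)
move=> z01 q1; pose m := (normc q.[z0] - 1) / 4.
have m0 : 0 < m by rewrite divr_gt0 // subr_gt0.
have [L L0 hL] := horner_lipschitz q 1.
pose r := (1 + normc z0) / 2.
have r0 : 0 <= r by rewrite divr_ge0 // addr_ge0 ?normc_ge0.
have r1 : r < 1 by rewrite /r; lra.
exists (Num.min (1 - r) (m / L)).
  by rewrite lt_min subr_gt0 r1 divr_gt0.
have [N1 hN1] := @escape_outside_disk R q _ m0.
have [N2 hN2] := expr_vanishing r0 r1 m0.
exists (maxn N1 N2) => n; rewrite geq_max => /andP[n1 n2] z.
rewrite lt_min => /andP[zr zL].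
have zr1 : normc z <= r by have := normc_sub_le z z0; rewrite /r in zr *; lra.
move=> /filled_julia_image; apply: hN1 => //.
have hq : normc (q.[z0] - q.[z]) <= m.
  apply: le_trans (hL _ _ _ _) _; try lra.
  by rewrite mulrC -ler_pdivlMr // normc_distC ltW.
have zn : normc (z ^+ n) <= m.
  rewrite normcX; apply: le_trans (hN2 _ n2).
  by rewrite lerXn2r ?nnegrE ?normc_ge0.
have := normc_sub_le q.[z] (- z ^+ n).
have := normc_sub_le q.[z0] q.[z].
rewrite normcN opprK [q.[z] + _]addrC.
have m4 : 4 * m = normc q.[z0] - 1 by rewrite /m mulrC mulfVK ?pnatr_eq0.
lra.
Qed.

(** Strict inequalities on [|q|] at a boundary point move to an interior point, where [z ^ n] is
    negligible; the point is [z0] shrunk radially. *)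
Lemma approach_interior q z0 (e : R) : 0 < e -> normc z0 <= 1 ->
  exists2 z, normc z < 1 & normc (q.[z] - q.[z0]) <= e.
Proof.
move=> e0 z01; have [L L0 hL] := horner_lipschitz q 1.
pose t := Num.min 1 (e / L).
have t0 : 0 < t by rewrite lt_min ltr01 divr_gt0.
have t1 : t <= 1 by rewrite ge_min lexx.
have tL : t * L <= e by rewrite -ler_pdivlMr // ge_min lexx orbT.
have z1 : normc ((1 - t)%:C%C * z0) < 1.
  rewrite normcM normc_real ger0_norm ?subr_ge0 //.
  have : (1 - t) * normc z0 <= (1 - t) * 1 by rewrite ler_wpM2l ?subr_ge0.
  lra.
exists ((1 - t)%:C%C * z0) => //.
apply: le_trans (hL _ _ (ltW z1) z01) _.
have -> : (1 - t)%:C%C * z0 - z0 = (- t%:C%C) * z0.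
  by rewrite rmorphB rmorph1; ring.
rewrite normcM normcN normc_real gtr0_norm //.
have : t * normc z0 <= t * 1 by rewrite ler_wpM2l // ltW.
rewrite mulr1 => h; apply: le_trans tL; rewrite mulrC ler_wpM2r // ltW //.
Qed.

(** The intermediate value theorem along the segment from [z0] to [z1], which stays in the disk by
    convexity. *)
Lemma exists_on_circle q z0 z1 : normc z0 < 1 -> normc z1 < 1 ->
  normc q.[z0] < 1 -> 1 < normc q.[z1] ->
  exists2 z, normc z < 1 & normc q.[z] = 1.
Proof.
move=> h0 h1 q0 q1.
pose gam (t : R) := z0 + t%:C%C * (z1 - z0).
pose phi (t : R) := normc q.[gam t].
have gam_cv (t : R) : 0 <= t -> t <= 1 -> normc (gam t) < 1.
  move=> t0 t1; have -> : gam t = (1 - t)%:C%C * z0 + t%:C%C * z1.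
    by rewrite /gam rmorphB rmorph1; ring.
  apply: le_lt_trans (le_normcD _ _) _; rewrite !normcM !normc_real.
  rewrite !ger0_norm ?subr_ge0 //.
  have [->|tn0] := eqVneq t 0; first by rewrite mul0r subr0 mul1r addr0.
  have tp : 0 < t by rewrite lt_def tn0.
  have : (1 - t) * normc z0 <= (1 - t) * 1.
    by rewrite ler_wpM2l ?subr_ge0 // ltW.
  have : t * normc z1 < t * 1 by rewrite ltr_pM2l.
  lra.
have cphi : continuous phi.
  move=> t; apply/cvgrPdist_le => e e0.
  have [L L0 hL] := horner_lipschitz q (normc z0 + (`|t| + 1) * normc (z1 - z0)).
  pose D := normc (z1 - z0) + 1.
  have D0 : 0 < D by rewrite ltr_wpDl ?normc_ge0.
  have gb (s : R) : `|s| <= `|t| + 1 ->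
      normc (gam s) <= normc z0 + (`|t| + 1) * normc (z1 - z0).
    move=> hs; apply: le_trans (le_normcD _ _) _.
    by rewrite normcM normc_real lerD2l ler_wpM2r ?normc_ge0.
  near=> s.
  have st : `|t - s| < Num.min 1 (e / (L * D)).
    near: s; apply: (@cvgr_dist_lt _ _ _ _ _ id t); first exact: cvg_id.
    by rewrite lt_min ltr01 divr_gt0 // mulr_gt0.
  move: st; rewrite lt_min => /andP[st1 st2].
  have hs : `|s| <= `|t| + 1.
    have := ler_normB t (t - s); rewrite opprB addrC subrK; lra.
  have ht : `|t| <= `|t| + 1 by lra.
  have hq := hL _ _ (gb _ ht) (gb _ hs).
  have hg : gam t - gam s = (t - s)%:C%C * (z1 - z0).
    by rewrite /gam rmorphB; ring.
  rewrite hg normcM normc_real in hq.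
  have hD : `|t - s| * normc (z1 - z0) <= `|t - s| * D.
    by rewrite ler_wpM2l // /D; lra.
  have he : L * (`|t - s| * D) <= e.
    by rewrite mulrCA -ler_pdivlMr ?mulr_gt0 // ltW.
  have hLD : L * (`|t - s| * normc (z1 - z0)) <= L * (`|t - s| * D).
    by rewrite ler_wpM2l // ltW.
  have := normc_sub_le q.[gam t] q.[gam s].
  have := normc_sub_le q.[gam s] q.[gam t].
  rewrite [normc (q.[gam s] - _)]normc_distC => ? ?.
  by rewrite /phi ler_norml; apply/andP; split; lra.
have phi0 : phi 0 = normc q.[z0] by rewrite /phi /gam mul0r addr0.
have phi1 : phi 1 = normc q.[z1] by rewrite /phi /gam rmorph1 mul1r addrC subrK.
have [|t] := @IVT R phi 0 1 1 ler01 (continuous_subspaceT cphi) _.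
  rewrite phi0 phi1 ge_min le_max; apply/andP; split.
    by rewrite (ltW q0).
  by rewrite (ltW q1) orbT.
rewrite in_itv /= => /andP[t0 t1] pt.
by exists (gam t) => //; apply: gam_cv.
Unshelve. all: by end_near.
Qed.

(** A Hurwitz-type argument: a fixed point [p] near [q z0] must have a preimage near [z0]. Otherwise
    [1 / (z ^ n + q z - p)] obeys the Cauchy bound on a small disk, yet it is larger at the centre
    than on the boundary. *)
Lemma filled_julia_near_circle_preimage q z0 (e : R) : 0 < e ->
  (2 <= (size q).-1)%N -> (forall z, normc z = 1 -> q.[z] <> z) ->
  normc z0 < 1 -> normc q.[z0] = 1 ->
  exists N, forall n, (N <= n)%N ->
    exists2 z, normc (z - z0) <= e & filled_julia (fam q n) z.
Proof.
move=> e0 dq hf z01 q1; pose Q := q - q.[z0]%:P.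
have QE z : Q.[z] = q.[z] - q.[z0] by rewrite hornerD hornerN hornerC.
have Q0 : Q != 0.
  apply/eqP => /eqP; rewrite subr_eq0 => /eqP qc; move: dq.
  by rewrite qc size_polyC; case: (_ != _).
have [t t0 ht] : exists2 t : R, 0 < t &
    forall x, root Q x -> x != z0 -> t <= normc (z0 - x).
  have [s _ [_ rs]] := poly_factor Q0.
  have [x|t t0 ht] := @lower_bound_seq R _ [seq x <- s | x != z0]
      (fun x => normc (z0 - x)).
    by rewrite mem_filter normc_gt0 subr_eq0 eq_sym => /andP[].
  by exists t => // x; rewrite rs => xs xz; apply: ht; rewrite mem_filter xz.
(* Every point of the circle of radius [rho] about [z0] is at distance at least [rho] from all roots
   of [Q], and that circle stays inside the unit disk. *)
pose rho := Num.min e (Num.min (t / 2) ((1 - normc z0) / 2)).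
have rho0 : 0 < rho by rewrite !lt_min e0 !divr_gt0 // subr_gt0.
have [rhoe rhot rhoz] : [/\ rho <= e, rho <= t / 2 & rho <= (1 - normc z0) / 2].
  by split; rewrite !ge_min lexx ?orbT.
have [c c0 hc] := horner_lower_bound Q0 rho0.
have hcirc z : normc (z - z0) = rho -> c <= normc Q.[z].
  move=> zrho; apply: hc => x Qx; have [->|xz] := eqVneq x z0.
    by rewrite zrho.
  have := ht _ Qx xz; have := normc_sub_trans z0 z x.
  rewrite [normc (z0 - z)]normc_distC zrho; lra.
have c80 : 0 < c / 8 by rewrite divr_gt0.
pose r := normc z0 + rho.
have r0 : 0 <= r by rewrite addr_ge0 ?normc_ge0 // ltW.
have r1 : r < 1 by rewrite /r; lra.
have [N1 hN1] := fixed_points_near_circle c80 hf.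
have [N2 hN2] := expr_vanishing r0 r1 c80.
exists (maxn N1 N2) => n; rewrite geq_max => /andP[n1 n2].
have [p pz pf] := hN1 _ n1 _ q1.
apply: contrapT => nojulia.
pose F := 'X^n + (q - p%:P).
have FE z : F.[z] = z ^+ n + q.[z] - p.
  by rewrite hornerD hornerXn hornerD hornerN hornerC addrA.
have F0 z : normc (z - z0) <= rho -> F.[z] != 0.
  move=> zr; rewrite FE subr_eq0; apply/eqP => zp; apply: nojulia.
  exists z; first exact: le_trans rhoe.
  by apply: filled_julia_preimage; rewrite zp; apply: filled_julia_fixed.
(* Rescaling carries the unit disk to the disk of radius [rho] about [z0]. *)
pose G := F \Po (rho%:C%C *: 'X + z0%:P).
have GE u : G.[u] = F.[rho%:C%C * u + z0].
  by rewrite horner_comp; congr (_.[_]); rewrite hornerD hornerZ hornerX hornerC.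
have nrho u : normc (rho%:C%C * u + z0 - z0) = rho * normc u.
  by rewrite addrK normcM normc_real gtr0_norm.
have G0 u : normc u <= 1 -> G.[u] != 0.
  by move=> u1; rewrite GE F0 // nrho ler_piMr // ltW.
have smallp z : normc (z - z0) <= rho -> normc (z ^+ n) <= c / 8.
  move=> zr; have zr' : normc z <= r by have := normc_sub_le z z0; rewrite /r; lra.
  rewrite normcX; apply: le_trans (hN2 _ n2).
  by rewrite lerXn2r ?nnegrE ?normc_ge0.
have FQ z : F.[z] = Q.[z] - (p - q.[z0] - z ^+ n) by rewrite FE QE; ring.
have FQle z : normc (z - z0) <= rho -> normc (p - q.[z0] - z ^+ n) <= c / 4.
  move=> /smallp zn; apply: le_trans (normcB _ _) _; lra.
have hGb u : normc u = 1 -> normc (G.[u]^-1) <= (3 * c / 4)^-1.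
  move=> u1; set z := rho%:C%C * u + z0.
  have zr : normc (z - z0) = rho by rewrite nrho u1 mulr1.
  have zr' : normc (z - z0) <= rho by rewrite zr.
  have h := normc_sub_le Q.[z] (p - q.[z0] - z ^+ n).
  have h1 := FQle _ zr'; have h2 := hcirc _ zr.
  rewrite normcV GE lef_pV2 ?posrE; first by rewrite FQ; lra.
    by rewrite normc_gt0 F0.
  by rewrite divr_gt0 // mulr_gt0.
(* At the centre the Cauchy bound loses nothing: it gives [|F z0| >= 3 c / 4], against
   [|F z0| <= c / 4] because [Q] vanishes there. *)
have n01 : normc 0 < 1 :> R by rewrite normc0.
have := cauchy_bound (disk_algebra_inv G0) hGb n01.
rewrite normc0 subr0 invr1 mulr1 GE mulr0 add0r normcV.
have z0r : normc (z0 - z0) <= rho by rewrite subrr normc0 ltW.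
rewrite lef_pV2 ?posrE ?normc_gt0 ?F0 ?divr_gt0 ?mulr_gt0 //.
rewrite FQ QE subrr sub0r normcN.
by have := FQle _ z0r; lra.
Qed.

End LimitSets.

(** * Hausdorff convergence *)

Section Hausdorff.
Variable R : realType.
Implicit Types (A B : set R[i]) (z w : R[i]).

Lemma hausdorff_dist_lt A B (e : R) : (hausdorff_dist A B < e%:E)%E ->
  (forall a, A a -> exists2 b, B b & normc (a - b) < e) /\
  (forall b, B b -> exists2 a, A a & normc (a - b) < e).
Proof.
rewrite /hausdorff_dist gt_max => /andP[h1 h2]; split => x hx.
- have := le_lt_trans (ereal_sup_ubound (imageP _ hx)) h1.
  by move=> /ereal_inf_lt[_ [b hb <-]]; rewrite lte_fin; exists b.
- have := le_lt_trans (ereal_sup_ubound (imageP _ hx)) h2.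
  by move=> /ereal_inf_lt[_ [a ha <-]]; rewrite lte_fin; exists a.
Qed.

Lemma hausdorff_dist_le A B (e : R) : B !=set0 ->
  (forall a, A a -> exists2 b, B b & normc (a - b) < e) ->
  (forall b, B b -> exists2 a, A a & normc (a - b) < e) ->
  (0 <= hausdorff_dist A B <= e%:E)%E.
Proof.
move=> [b0 hb0] h1 h2; rewrite /hausdorff_dist le_max ge_max.
apply/andP; split.
  (* Nonnegativity is read off the supremum over the nonempty [B]: the other one is [-oo] if [A] is
     empty. *)
  apply/orP; right; apply: le_trans (ereal_sup_ubound (imageP _ hb0)).
  by apply/ereal_infP => _ [a _ <-]; rewrite lee_fin normc_ge0.
apply/andP; split; apply/ereal_supP => _ [x hx <-].
- have [b hb xb] := h1 _ hx.
  apply: le_trans (ereal_inf_lbound (imageP _ hb)) _.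
  by rewrite lee_fin ltW.
- have [a ha xa] := h2 _ hx.
  apply: le_trans (ereal_inf_lbound _) _; first by exists a; [exact: ha|reflexivity].
  by rewrite lee_fin ltW.
Qed.

Lemma hausdorff_cvgP (A_ : nat -> set R[i]) A : A !=set0 ->
  hausdorff_cvg A_ A <-> forall e : R, 0 < e ->
    exists N, forall n, (N <= n)%N ->
      (forall a, A_ n a -> exists2 b, A b & normc (a - b) < e) /\
      (forall b, A b -> exists2 a, A_ n a & normc (a - b) < e).
Proof.
move=> A0; split.
  move=> /fine_cvgP[[N1 _ h1] /cvgrPdist_lt h2] e /h2[N2 _ hN2].
  exists (maxn N1 N2) => n; rewrite geq_max => /andP[n1 n2].
  apply: hausdorff_dist_lt; rewrite -(fineK (h1 _ n1)) lte_fin.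
  have := hN2 _ n2; rewrite /= sub0r normrN; apply: le_lt_trans.
  exact: ler_norm.
move=> h; apply/fine_cvgP; split.
  have [N hN] := h 1 ltr01; exists N => // n /hN[h1 h2].
  have /andP[a b] := hausdorff_dist_le A0 h1 h2.
  by rewrite ge0_fin_numE // (le_lt_trans b) // ltry.
apply/cvgrPdist_le => e /h[N hN]; exists N => // n /hN[h1 h2] /=.
have /andP[a b] := hausdorff_dist_le A0 h1 h2.
rewrite sub0r normrN ger0_norm ?fine_ge0 //.
by rewrite -lee_fin fineK // ge0_fin_numE // (le_lt_trans b) // ltry.
Qed.

Lemma radial_approx z : 0 < normc z ->
  exists2 w, normc w = 1 & normc (z - w) = `|normc z - 1|.
Proof.
move=> z0; exists ((normc z)^-1%:C%C * z).
  by rewrite normcM normc_real ger0_norm ?invr_ge0 ?normc_ge0 // mulVf // gt_eqF.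
have -> : z - (normc z)^-1%:C%C * z = (1 - (normc z)^-1)%:C%C * z.
  by rewrite rmorphB rmorph1; ring.
rewrite normcM normc_real -{2}[normc z](gtr0_norm z0) -normrM.
by rewrite mulrBl mul1r mulVf // gt_eqF.
Qed.

End Hausdorff.

(** * Both equivalences, from trapping, escape and density of fixed points *)

Theorem corollary1p5 (R : realType) (q : {poly R[i]})
    (deg_q : (2 <= (size q).-1)%N)
    (no_fix : forall z : R[i], unit_circle R z -> q.[z] <> z) :
  let f (n : nat) (z : R[i]) := z ^+ n + q.[z] in
  (hausdorff_cvg (fun n => filled_julia (f n)) (closed_unit_disk R) <->
     horner q @` closed_unit_disk R `<=` closed_unit_disk R) /\
  (hausdorff_cvg (fun n => filled_julia (f n)) (unit_circle R) <->
     horner q @` closed_unit_disk R `&` unit_disk R = set0).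
Proof.
move=> f.
have n01 : normc (0 : R[i]) <= 1 by rewrite normc0.
have D0 : closed_unit_disk R !=set0 by exists 0; exact: n01.
have S0 : unit_circle R !=set0 by exists 1; exact: normc1.
(* Isolated because convergence to the circle also uses it, to exclude this case. *)
have disk_cvg : horner q @` closed_unit_disk R `<=` closed_unit_disk R ->
    hausdorff_cvg (fun n => filled_julia (f n)) (closed_unit_disk R).
  move=> hq; apply/(hausdorff_cvgP _ D0) => e e0.
  have hq' z : normc z <= 1 -> normc q.[z] <= 1.
    by move=> z1; apply: hq; exists z.
  have e20 : 0 < e / 2 by rewrite divr_gt0.
  have [N1 hN1] := @escape_outside_disk R q _ e20.
  pose t := Num.min 1 (e / 2).
  have t0 : 0 < t by rewrite lt_min ltr01.
  have t1 : t <= 1 by rewrite ge_min lexx.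
  have te : t <= e / 2 by rewrite ge_min lexx orbT.
  have r0 : 0 <= 1 - t by lra.
  have r1 : 1 - t < 1 by lra.
  have [N2 hN2] := disk_in_filled_julia deg_q no_fix hq' r0 r1.
  exists (maxn N1 N2) => n; rewrite geq_max => /andP[n1 n2]; split.
    move=> a Ka; case: (leP (normc a) 1) => a1.
      by exists a => //; rewrite subrr normc0.
    have [|w w1 aw] := radial_approx (z := a); first by lra.
    exists w; first by rewrite /closed_unit_disk /= w1.
    rewrite aw gtr0_norm ?subr_gt0 //.
    have : normc a < 1 + e / 2.
      by rewrite ltNge; apply/negP => /(hN1 _ n1); apply.
    lra.
  move=> b; rewrite /closed_unit_disk /= => b1.
  exists ((1 - t)%:C%C * b).
    apply: hN2 => //; rewrite normcM normc_real ger0_norm //.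
    by rewrite ler_piMr.
  have -> : (1 - t)%:C%C * b - b = (- t%:C%C) * b.
    by rewrite rmorphB rmorph1; ring.
  rewrite normcM normcN normc_real gtr0_norm //.
  have : t * normc b <= t * 1 by rewrite ler_wpM2l // ltW.
  lra.
split; split => //.
- move=> /(hausdorff_cvgP _ D0) hcv _ [z0 z01 <-].
  rewrite /closed_unit_disk /= leNgt; apply/negP => q1.
  have m0 : 0 < (normc q.[z0] - 1) / 2 by rewrite divr_gt0 // subr_gt0.
  have [z z1 hz] := approach_interior q m0 z01.
  have qz : 1 < normc q.[z].
    by have := normc_sub_le q.[z0] q.[z]; rewrite normc_distC; lra.
  have [e e0 [N1 hN1]] := ball_escapes z1 qz.
  have [N2 hN2] := hcv _ e0.
  have [_ h] := hN2 _ (leq_maxr N1 N2).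
  have [|a Ka az] := h z; first exact: ltW.
  exact: (hN1 _ (leq_maxl N1 N2) a).
- move=> hcv; apply/seteqP; split => // _ [[z0 z01 <-]].
  rewrite /unit_disk /= => q1.
  have m0 : 0 < (1 - normc q.[z0]) / 2 by rewrite divr_gt0 // subr_gt0.
  have [z z1 hz] := approach_interior q m0 z01.
  have qz : normc q.[z] < 1 by have := normc_sub_le q.[z] q.[z0]; lra.
  move/(hausdorff_cvgP _ S0) : hcv => hcv.
  (* If [q] preserves the disk, the sets also converge to the disk, so some point of them lies
     within [1 / 3] of both 0 and the circle. Otherwise [|q|] takes values on both sides of 1 inside
     the disk. *)
  case: (EM (horner q @` closed_unit_disk R `<=` closed_unit_disk R)) => hq.
    move: (disk_cvg hq) => /(hausdorff_cvgP _ D0) hcv'.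
    have h3 : 0 < 1 / 3 :> R by rewrite divr_gt0.
    have [N1 hN1] := hcv _ h3; have [N2 hN2] := hcv' _ h3.
    have [h1 _] := hN1 _ (leq_maxl N1 N2).
    have [_ h2] := hN2 _ (leq_maxr N1 N2).
    have [|a Ka a0] := h2 0; first exact: n01.
    have [b b1 ab] := h1 _ Ka; rewrite subr0 in a0.
    rewrite /unit_circle /= in b1.
    by have := normc_sub_le b a; rewrite normc_distC; lra.
  have [z2 z21 q2] : exists2 z2, normc z2 <= 1 & 1 < normc q.[z2].
    apply: contrapT => hn; apply: hq => _ [x x1 <-].
    rewrite /closed_unit_disk /= leNgt; apply/negP => qx; apply: hn.
    by exists x.
  have m2 : 0 < (normc q.[z2] - 1) / 2 by rewrite divr_gt0 // subr_gt0.
  have [z3 z31 hz3] := approach_interior q m2 z21.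
  have qz3 : 1 < normc q.[z3].
    by have := normc_sub_le q.[z2] q.[z3]; rewrite normc_distC; lra.
  have [w w1 qw] := exists_on_circle z1 z31 qz qz3.
  (* Two steps of at most this length, the second one strictly shorter, cannot lead from [w] to the
     unit circle. *)
  have m3 : 0 < (1 - normc w) / 2 by rewrite divr_gt0 // subr_gt0.
  have [N1 hN1] := filled_julia_near_circle_preimage m3 deg_q no_fix w1 qw.
  have [N2 hN2] := hcv _ m3.
  have [x xw Kx] := hN1 _ (leq_maxl N1 N2).
  have [h _] := hN2 _ (leq_maxr N1 N2).
  have [b b1 xb] := h _ Kx; rewrite /unit_circle /= in b1.
  have := normc_sub_le b x; have := normc_sub_le x w.
  by rewrite [normc (b - x)]normc_distC; lra.
- move=> hq; apply/(hausdorff_cvgP _ S0) => e e0.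
  have hq' z : normc z <= 1 -> 1 <= normc q.[z].
    move=> z1; rewrite leNgt; apply/negP => qz.
    suff : (set0 : set R[i]) q.[z] by [].
    by rewrite -hq; split => //; exists z.
  have e20 : 0 < e / 2 by rewrite divr_gt0.
  have [N1 hN1] := @escape_outside_disk R q _ e20.
  (* The cap [1 / 2] keeps the surviving points away from 0, where radial projection is
     undefined. *)
  pose t := Num.min (1 / 2) (e / 2).
  have t0 : 0 < t by rewrite lt_min e20 divr_gt0.
  have t1 : t <= 1 / 2 by rewrite ge_min lexx.
  have te : t <= e / 2 by rewrite ge_min lexx orbT.
  have r0 : 0 <= 1 - t by lra.
  have r1 : 1 - t < 1 by lra.
  have [N2 hN2] := disk_escapes deg_q no_fix hq' r0 r1.
  have [N3 hN3] := fixed_points_near_circle e0 no_fix.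
  exists (maxn N1 (maxn N2 N3)) => n; rewrite !geq_max => /and3P[n1 n2 n3].
  split.
    move=> a Ka.
    have ha1 : normc a < 1 + e / 2.
      by rewrite ltNge; apply/negP => /(hN1 _ n1); apply.
    have ha2 : 1 - t < normc a.
      by rewrite ltNge; apply/negP => /(hN2 _ n2); apply.
    have [|w w1 aw] := radial_approx (z := a); first by lra.
    exists w => //; rewrite aw ltr_norml; apply/andP; split; lra.
  move=> b /(hN3 _ n3)[z zb fz]; exists z => //.
  exact: filled_julia_fixed.
Qed.
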